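(* Let $(x^i_k)_{i\in[n],k\in[K]}$ and $(\hat x^i_k)_{i\in[n],k\in[K]}$ denote the iterates of Interacting Particle Dynamics (IPD) and the Random Batch Method (RBM) with batch size $B$ respectively, with the same initial distribution, the same step size $\eta>0$ and the same diffusion strength $\sigma>0$. Suppose $\|\mathbf K^{ij}_k(\hat x^i_k,\hat x^j_k)\|\le M$ holds almost surely for every $k\in\{0,1,\dots,K\}$ and $i,j\in[n]$. Then, for every $\eta\le\frac{B\sigma^2}{40M^2d}$, up to a universal multiplicative constant, $$\mathsf{KL}\left(\mathrm{Law}\big((\hat x^i_k)_{i\in[n],k\in[K]}\big)\,\big\|\,\mathrm{Law}\big((x^i_k)_{i\in[n],k\in[K]}\big)\right)\lesssim\frac{\eta^2M^4nK}{B^2\sigma^4}+\frac{d\,\eta^3M^6nK(1+\log B)^2}{B^4\sigma^6}.$$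
   Context: $[m]=\{1,\dots,m\}$. There are $n$ particles in $\mathbb R^d$, with external forces $\mathbf g^i_k:\mathbb R^d\to\mathbb R^d$ and interaction forces $\mathbf K^{ij}_k:\mathbb R^d\times\mathbb R^d\to\mathbb R^d$ ($i,j\in[n]$, $k\ge0$). The initial positions of the $n$ particles have an arbitrary joint distribution. IPD: $x^i_{k+1}=x^i_k+\eta\,\mathbf g^i_k(x^i_k)+\frac\eta n\sum_{j=1}^n\mathbf K^{ij}_k(x^i_k,x^j_k)+\sqrt\eta\,\sigma\,\epsilon^i_k$ for $i\in[n]$, with $\epsilon^i_k\sim\mathcal N(0,I)$ i.i.d. and independent of the initial positions. RBM with batch size $B\in[n]$: at each step $k$ and for each $i$ draw $I^{i1}_k,\dots,I^{iB}_k$ i.i.d. uniform on $[n]$, independent of everything else, put $\hat{\mathbf K}^i_k(\hat x_k)=\frac1B\sum_{j=1}^B\mathbf K_k^{iI^{ij}_k}(\hat x^i_k,\hat x_k^{I^{ij}_k})$, and set $\hat x^i_{k+1}=\hat x^i_k+\eta\,\mathbf g^i_k(\hat x^i_k)+\eta\,\hat{\mathbf K}^i_k(\hat x_k)+\sqrt\eta\,\sigma\,\epsilon^i_k$, with $\epsilon^i_k\sim\mathcal N(0,I)$ i.i.d., independent of everything else. *)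

(* Defs.v *)
From HB Require Import structures.
From mathcomp Require Import all_boot all_order all_algebra.
From mathcomp Require Import all_classical all_reals all_analysis.

Set Implicit Arguments.
Unset Strict Implicit.
Unset Printing Implicit Defensive.

Import Order.TTheory GRing.Theory Num.Theory.
Import numFieldNormedType.Exports.

Local Open Scope classical_set_scope.
Local Open Scope ring_scope.

Definition mx_display : measure_display.
Proof. exact: default_measure_display. Qed.

(* The Borel sigma-algebra of R^d, generated by the coordinates, as the library
   does for tuples. *)
Section measurable_matrix.
Context {R : realType} {m d : nat}.

Definition measurable_mx : set_system 'M[R]_(m, d) :=
  <<s \bigcup_(e in [set: 'I_m * 'I_d]) g_sigma_algebra_preimage
        (fun A : 'M[R]_(m, d) => A e.1 e.2 : measurableTypeR R) >>.

Let mx_set0 : measurable_mx set0.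
Proof. exact: sigma_algebra0. Qed.

Let mx_setC A : measurable_mx A -> measurable_mx (~` A).
Proof. exact: sigma_algebraC. Qed.

Let mx_bigcup (F : (set 'M[R]_(m, d))^nat) :
  (forall i, measurable_mx (F i)) -> measurable_mx (\bigcup_i F i).
Proof. exact: sigma_algebra_bigcup. Qed.

HB.instance Definition _ := @isMeasurable.Build mx_display
  'M[R]_(m, d) measurable_mx mx_set0 mx_setC mx_bigcup.

End measurable_matrix.

(* The library's norm on row vectors is the sup norm. *)
Definition norm2 {R : realType} {d : nat} (v : 'rV[R]_d) : R :=
  Num.sqrt (\sum_(j < d) v ord0 j ^+ 2).

Section independence.
Context {dT : measure_display} {T : measurableType dT} {R : realType}.
Variable P : probability T R.

Definition independent_systems (J : eqType) (F : J -> set_system T) : Prop :=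
  forall (s : seq J) (A : J -> set T), uniq s ->
    (forall j, j \in s -> F j (A j)) ->
    P (\bigcap_(j in [set` s]) A j) = (\prod_(j <- s) P (A j))%E.

Definition standard_gaussian (d : nat) (X : {RV P >-> 'rV[R]_d}) : Prop :=
  independent_systems (fun j : 'I_d =>
    g_sigma_algebra_preimage (fun w => X w ord0 j : measurableTypeR R)) /\
  forall (j : 'I_d) (A : set (measurableTypeR R)), measurable A ->
    pushforward P (fun w => X w ord0 j : measurableTypeR R) A =
    normal_prob 0 1 A.

(* Every subset of the finite set 'I_n is measurable. *)
Definition sigma_ord (n : nat) (I : T -> 'I_n) : set_system T :=
  preimage_set_system setT I setT.

Definition uniform_ord (n : nat) (I : T -> 'I_n) : Prop :=
  sigma_ord I `<=` measurable /\
  forall a : 'I_n, P (I @^-1` [set a]) = (n%:R^-1)%:E.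

End independence.

Section kullback_leibler.
Context {dT : measure_display} {T : measurableType dT} {R : realType}.
Local Open Scope ereal_scope.
Local Open Scope charge_scope.

Definition KL (mu nu : probability T R) : \bar R :=
  if `[< mu `<< nu >] then
    \int[mu]_z lne (('d (charge_of_finite_measure mu) '/d nu) z)
  else +oo.

End kullback_leibler.

Section particle_systems.
Context {R : realType} {n d : nat}.
Context {dT : measure_display} {T : measurableType dT} {P : probability T R}.

Definition process := nat -> 'I_n -> {RV P >-> 'rV[R]_d}.

Implicit Types x noise : process.

Definition config x (k : nat) (w : T) : n.-tuple 'rV[R]_d :=
  [tuple x k i w | i < n].

(* Iterates x_1, ..., x_K : the range [K] starts at 1. *)
Definition trajectory x (K : nat) (w : T) : K.-tuple (n.-tuple 'rV[R]_d) :=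
  [tuple config x k.+1 w | k < K].

Lemma measurable_config x k : measurable_fun setT (config x k).
Proof.
apply/measurable_fun_tnthP => i.
apply: (eq_measurable_fun (x k i : T -> _)) => [w _|]; last exact: measurable_funPT.
by rewrite /= tnth_mktuple.
Qed.

HB.instance Definition _ x k := isMeasurableFun.Build _ _ _ _
  (config x k) (measurable_config x k).

Lemma measurable_trajectory x K : measurable_fun setT (trajectory x K).
Proof.
apply/measurable_fun_tnthP => k.
apply: (eq_measurable_fun (config x k.+1)) => [w _|]; last exact: measurable_config.
by rewrite /= tnth_mktuple.
Qed.

HB.instance Definition _ x K := isMeasurableFun.Build _ _ _ _
  (trajectory x K) (@measurable_trajectory x K).

Variables (g : nat -> 'I_n -> 'rV[R]_d -> 'rV[R]_d).
Variables (F : nat -> 'I_n -> 'I_n -> 'rV[R]_d -> 'rV[R]_d -> 'rV[R]_d).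
Variables (eta sigma : R).

(* The n initial positions form a single source: their joint law is arbitrary. *)
Definition ipd_sources x noise (s : unit + nat * 'I_n) : set_system T :=
  match s with
  | inl _ => g_sigma_algebra_preimage (config x 0)
  | inr (k, i) => g_sigma_algebra_preimage (noise k i)
  end.

Definition is_IPD x noise : Prop :=
  [/\ forall k i, standard_gaussian (noise k i),
      independent_systems P (ipd_sources x noise)
    & forall k i w, x k.+1 i w =
        x k i w + eta *: g k i (x k i w)
        + (eta / n%:R) *: (\sum_(j < n) F k i j (x k i w) (x k j w))
        + (Num.sqrt eta * sigma) *: noise k i w].

Section random_batch.
Variables (B : nat) (I : nat -> 'I_n -> 'I_B -> T -> 'I_n).

Definition rbm_sources x noise
    (s : unit + nat * 'I_n + nat * 'I_n * 'I_B) : set_system T :=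
  match s with
  | inl s' => ipd_sources x noise s'
  | inr (k, i, b) => sigma_ord (I k i b)
  end.

Definition batch_force x k (i : 'I_n) (w : T) : 'rV[R]_d :=
  B%:R^-1 *: (\sum_(b < B)
    F k i (I k i b w) (x k i w) (x k (I k i b w) w)).

Definition is_RBM x noise : Prop :=
  [/\ forall k i, standard_gaussian (noise k i),
      forall k i b, uniform_ord P (I k i b),
      independent_systems P (rbm_sources x noise)
    & forall k i w, x k.+1 i w =
        x k i w + eta *: g k i (x k i w)
        + eta *: batch_force x k i w
        + (Num.sqrt eta * sigma) *: noise k i w].

End random_batch.
End particle_systems.

Arguments process {R} n d {dT T} P.

(* Main.v *)
(* Conditionally on the positions at time [k], both systems take a Gaussian step with
   the same covariance; the drift of the random batch step is random, with mean the drift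
   of the full interaction. The ratio of the two transition densities, a mixture of
   Cameron-Martin densities [exp (<u_a, e> - |u_a|^2 / 2)] over the batches [a], has second
   moment [sum_(a, b) w^2 exp <u_a, u_b>] under the full dynamics. As a batch average is a
   mean of [B] independent centred vectors of norm at most [2 M], two applications of
   Hoeffding's argument bound this by [exp (64 eta^2 M^4 n / (B^2 sigma^4))], without any
   dependence on [d]. These bounds multiply along the trajectory, so the second moment of
   the likelihood ratio of the whole paths is at most [exp (64 eta^2 M^4 n K / (B^2 sigma^4))],
   and its logarithm dominates the relative entropy, by Jensen. Forgetting the initial
   positions does not increase the second moment. *)

Require Import Defs.
From HB Require Import structures.
From mathcomp Require Import all_boot all_order all_algebra.
From mathcomp Require Import all_classical all_reals all_analysis.
From mathcomp Require Import measurable_realfun ring lra.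

Set Implicit Arguments.
Unset Strict Implicit.
Unset Printing Implicit Defensive.

Import Order.TTheory GRing.Theory Num.Theory.
Import numFieldNormedType.Exports.

Local Open Scope classical_set_scope.
Local Open Scope ring_scope.

(** * Exponential moments of batch averages *)

(** The force bound is known only along the random batch trajectory, whereas the second moment is
    taken under the interacting dynamics, which may visit configurations with large forces. Each
    factor of the likelihood ratio therefore carries the indicator of the configurations where all
    forces are bounded by [M]: it is one almost surely under the random batch law, and it makes the
    moment bound hold at every path. The ratio is never compared with the Radon-Nikodym derivative
    in [KL]. It only serves to prove [2 \int h dmu <= e^r + \int h^2 dnu] for all test functions
    [h >= 0], an inequality that passes to image laws by composing [h] with the map. The constant 64
    is [4 * 4^2]: centred forces have squared norm at most [q = 4 M^2], and each particle
    contributes [exp (4 (q s B)^2)] with [s = eta / (B^2 sigma^2)]. *)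

Section entrywise_product.
Context {R : realType} {m d : nat}.
Implicit Types A B C : 'M[R]_(m, d).

Definition mxdot A B : R := \sum_i \sum_j A i j * B i j.

Lemma mxdotC A B : mxdot A B = mxdot B A.
Proof. by apply: eq_bigr => i _; apply: eq_bigr => j _; rewrite mulrC. Qed.

Lemma mxdotDl A B C : mxdot (A + B) C = mxdot A C + mxdot B C.
Proof.
rewrite /mxdot -big_split; apply: eq_bigr => i _; rewrite -big_split.
by apply: eq_bigr => j _; rewrite mxE mulrDl.
Qed.

Lemma mxdotZl t A B : mxdot (t *: A) B = t * mxdot A B.
Proof.
rewrite /mxdot mulr_sumr; apply: eq_bigr => i _; rewrite mulr_sumr.
by apply: eq_bigr => j _; rewrite mxE mulrA.
Qed.

Lemma mxdotDr A B C : mxdot A (B + C) = mxdot A B + mxdot A C.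
Proof. by rewrite mxdotC mxdotDl !(mxdotC _ A). Qed.

Lemma mxdotZr t A B : mxdot A (t *: B) = t * mxdot A B.
Proof. by rewrite mxdotC mxdotZl mxdotC. Qed.

Lemma mxdot0l B : mxdot 0 B = 0.
Proof. by rewrite -(scale0r (0 : 'M[R]_(m, d))) mxdotZl mul0r. Qed.

Lemma mxdot_suml (I : Type) (r : seq I) (A : I -> 'M[R]_(m, d)) B :
  mxdot (\sum_(i <- r) A i) B = \sum_(i <- r) mxdot (A i) B.
Proof.
elim: r => [|i r ih]; first by rewrite !big_nil mxdot0l.
by rewrite !big_cons mxdotDl ih.
Qed.

Lemma mxdot_sqr_ge0 A : 0 <= mxdot A A.
Proof. by apply: sumr_ge0 => i _; apply: sumr_ge0 => j _; rewrite -expr2 sqr_ge0. Qed.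

Lemma mxdot_sqrD A B : mxdot (A + B) (A + B) = mxdot A A + 2 * mxdot A B + mxdot B B.
Proof. by rewrite mxdotDl !mxdotDr (mxdotC B A); ring. Qed.

Lemma mxdot_cauchy_schwarz A B : mxdot A B ^+ 2 <= mxdot A A * mxdot B B.
Proof.
have := mxdot_sqr_ge0 B; rewrite le_eqVlt => /predU1P[B0|B0].
  suff -> : mxdot A B = 0 by rewrite expr0n mulr_ge0 ?mxdot_sqr_ge0.
  have Bij i j : B i j = 0.
    have nn k l : 0 <= B k l * B k l by rewrite -expr2 sqr_ge0.
    have /eqP := esym B0; rewrite psumr_eq0; last by move=> k _; apply: sumr_ge0.
    move=> /allP/(_ i (mem_index_enum _))/eqP/eqP.
    rewrite psumr_eq0// => /allP/(_ j (mem_index_enum _))/eqP/eqP.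
    by rewrite mulf_eq0 orbb => /eqP.
  by apply: big1 => i _; apply: big1 => j _; rewrite Bij mulr0.
have := mxdot_sqr_ge0 (mxdot B B *: A + - mxdot A B *: B).
rewrite mxdot_sqrD !(mxdotZl, mxdotZr) => h.
rewrite -subr_ge0 -(pmulr_rge0 _ B0); apply: le_trans h _.
by rewrite le_eqVlt; apply/orP; left; apply/eqP; ring.
Qed.

End entrywise_product.

Lemma mxdot_row (R : realType) m d (A B : 'M[R]_(m, d)) :
  mxdot A B = \sum_i mxdot (row i A) (row i B).
Proof.
apply: eq_bigr => i _; rewrite /mxdot big_ord1.
by apply: eq_bigr => j _; rewrite !mxE.
Qed.

Lemma norm2_sqr (R : realType) d (v : 'rV[R]_d) : norm2 v ^+ 2 = mxdot v v.
Proof.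
rewrite sqr_sqrtr; last by apply: sumr_ge0 => j _; rewrite sqr_ge0.
by rewrite /mxdot big_ord1; apply: eq_bigr => j _; rewrite expr2.
Qed.

Section exponential_moments.
Context {R : realType}.
Local Notation expR := (@expR R).

(** The linear term cancels in the mean of a centred family, so a sub-Gaussian bound remains, with
    no restriction on the size of [t]. *)
Lemma expR_le_addr_expR_sqr (t : R) : expR t <= t + expR (2 * t ^+ 2).
Proof.
have [t2|t2] := leP t (1 / 2); last first.
  have : t <= 2 * t ^+ 2 by nra.
  rewrite -ler_expR; lra.
apply: (@le_trans _ _ (t + (1 + 2 * t ^+ 2))); last by rewrite lerD2l expR_ge1Dx.
(* Inverting this bound reduces the claim to [1 <= (1 - t) (1 + t + 2 t^2)]. The product is
   [1 + t^2 (1 - 2 t)], and [t <= 1 / 2]. *)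
have h : 1 - t <= expR (- t) by rewrite -[1 - t]/(1 + - t) expR_ge1Dx.
rewrite -[expR t]invrK -expRN -[leRHS]invrK lef_pV2 ?posrE ?expR_gt0 ?invr_gt0//; last by nra.
apply: le_trans h; rewrite -[leLHS]mul1r ler_pdivrMr; last by nra.
nra.
Qed.

(** Hoeffding's argument for one uniform draw: the linear terms sum to zero, and Cauchy-Schwarz
    bounds the squares left in the exponent. *)
Lemma mean_expR_le d n (Y : 'I_n -> 'rV[R]_d) (v : 'rV[R]_d) (q s : R) :
  (0 < n)%N -> \sum_j Y j = 0 -> (forall j, mxdot (Y j) (Y j) <= q) ->
  n%:R^-1 * \sum_j expR (s * mxdot (Y j) v) <=
  expR (2 * s ^+ 2 * q * mxdot v v).
Proof.
move=> n0 Y0 Yq; rewrite ler_pdivrMl ?ltr0n//.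
apply: (@le_trans _ _ (\sum_j (s * mxdot (Y j) v + expR (2 * (s * mxdot (Y j) v) ^+ 2)))).
  by apply: ler_sum => j _; exact: expR_le_addr_expR_sqr.
rewrite big_split/= -mulr_sumr -mxdot_suml Y0 mxdot0l mulr0 add0r.
have -> : n%:R * expR (2 * s ^+ 2 * q * mxdot v v) =
    \sum_(j < n) expR (2 * s ^+ 2 * q * mxdot v v).
  by rewrite sumr_const card_ord mulr_natl.
apply: ler_sum => j _; rewrite ler_expR exprMn mulrA -(mulrA _ q).
rewrite ler_wpM2l//; first by rewrite pmulr_rge0// sqr_ge0.
apply: le_trans (mxdot_cauchy_schwarz _ _) _.
by rewrite ler_wpM2r ?mxdot_sqr_ge0.
Qed.

Lemma big_ffun_recl (V : nmodType) (T : finType) b (f : {ffun 'I_b.+1 -> T} -> V) :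
  \sum_c f c =
  \sum_j \sum_(c : {ffun 'I_b -> T})
    f [ffun i => if unlift ord0 i is Some k then c k else j].
Proof.
rewrite pair_bigA/=.
rewrite (reindex (fun p : T * {ffun 'I_b -> T} =>
  [ffun i => if unlift ord0 i is Some k then p.2 k else p.1])) //=.
exists (fun c : {ffun 'I_b.+1 -> T} => (c ord0, [ffun k => c (lift ord0 k)])).
  move=> [j c] _ /=; rewrite ffunE unlift_none; congr pair.
  by apply/ffunP => k; rewrite !ffunE liftK.
move=> c _; apply/ffunP => i; rewrite ffunE /=.
by case: unliftP => [k|] ->; rewrite ?ffunE.
Qed.

(* Peeling off one summand turns [lam] into [lam + 8 q lam^2]; the budget on [lam]
   keeps it below [2 l] during all [B] peelings. *)
Lemma mean_expR_sqr_sum_le d n (Y : 'I_n -> 'rV[R]_d) (q l : R) B b (lam : R) :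
  (0 < n)%N -> \sum_j Y j = 0 -> (forall j, mxdot (Y j) (Y j) <= q) ->
  0 <= l -> 32 * q * l * B%:R <= 1 ->
  (b <= B)%N -> 0 <= lam -> lam * B%:R <= l * (2 * B%:R - b%:R) ->
  \sum_(c : {ffun 'I_b -> 'I_n}) n%:R^-1 ^+ b *
     expR (lam * mxdot (\sum_k Y (c k)) (\sum_k Y (c k)))
  <= expR (2 * b%:R * l * q).
Proof.
move=> n0 Y0 Yq l0 lB.
have q0 : 0 <= q by apply: le_trans (Yq (Ordinal n0)); exact: mxdot_sqr_ge0.
have nV0 : 0 <= n%:R^-1 :> R by rewrite invr_ge0.
elim: b lam => [|b ih] lam bB lam0 lamB.
  rewrite (eq_bigr (fun=> 1)); last first.
    by move=> c _; rewrite expr0 mul1r big_ord0 mxdot0l mulr0 expR0.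
  rewrite sumr_const card_ffun !card_ord expn0 mulr1n.
  by rewrite mulr0 !mul0r expR0.
have B0 : 0 < B%:R :> R by rewrite ltr0n (leq_trans _ bB).
pose lam' := lam + 8 * q * lam ^+ 2.
rewrite big_ffun_recl exchange_big/=.
apply: (@le_trans _ _ (expR (2 * l * q) *
  \sum_(c : {ffun 'I_b -> 'I_n}) n%:R^-1 ^+ b *
     expR (lam' * mxdot (\sum_k Y (c k)) (\sum_k Y (c k))))).
  rewrite mulr_sumr; apply: ler_sum => c _.
  set s := \sum_k Y (c k).
  have E j : \sum_k Y ([ffun i => if unlift ord0 i is Some k then c k else j] k) = Y j + s.
    rewrite big_ord_recl ffunE unlift_none; congr (_ + _).
    by apply: eq_bigr => k _; rewrite ffunE liftK.
  under eq_bigr do rewrite E exprSr -mulrA.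
  rewrite -!mulr_sumr [leRHS]mulrCA ler_wpM2l ?exprn_ge0//.
  (* Expand [|Y j + s|^2] and bound [|Y j|^2] by [q]. The cross term is averaged by [mean_expR_le]
     at [2 * lam], which produces the [8 q lam^2] in [lam']. *)
  apply: (@le_trans _ _ (n%:R^-1 * \sum_j (expR (lam * mxdot s s + lam * q) *
       expR (2 * lam * mxdot (Y j) s)))).
    rewrite ler_wpM2l//; apply: ler_sum => j _.
    rewrite -expRD ler_expR mxdot_sqrD.
    have := Yq j; set y := mxdot (Y j) (Y j) => yq; nra.
  rewrite -mulr_sumr mulrCA.
  apply: le_trans (ler_wpM2l (expR_ge0 _) (mean_expR_le _ _ n0 Y0 Yq)) _.
  rewrite -!expRD ler_expR /lam'.
  have : lam * q <= 2 * l * q.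
    apply: ler_wpM2r => //; rewrite -(ler_pM2r B0); apply: le_trans lamB _.
    by have := ler0n R b.+1; nra.
  by move: (mxdot s s) => z; lra.
rewrite [X in _ <= expR X](_ : _ = 2 * l * q + 2 * b%:R * l * q); last first.
  by rewrite -natr1; ring.
rewrite expRD ler_pM2l ?expR_gt0// ih//; first exact: ltnW.
  by rewrite addr_ge0// !mulr_ge0// ?sqr_ge0.
move: lamB; rewrite -natr1 /lam' => lamB.
(* One peeling may use up [l] of the budget [l (2 B - b)]. Since [lam <= 2 l], the increment times
   [B] is at most [32 q l B * l]. *)
have h : 8 * q * lam ^+ 2 * B%:R <= l.
  have lam2 : lam <= 2 * l.
    by rewrite -(ler_pM2r B0); apply: le_trans lamB _; have := ler0n R b; nra.
  have -> : 8 * q * lam ^+ 2 * B%:R = 8 * q * B%:R * lam ^+ 2 by ring.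
  apply: (@le_trans _ _ (8 * q * B%:R * (2 * l) ^+ 2)).
    by rewrite ler_wpM2l ?mulr_ge0// lerXn2r// nnegrE// mulr_ge0.
  have -> : 8 * q * B%:R * (2 * l) ^+ 2 = 32 * q * l * B%:R * l by ring.
  by rewrite -[leRHS]mul1r ler_wpM2r.
lra.
Qed.

(** With one batch sum [v] frozen, the other is a sum of [B] independent draws, so its exponential
    moment is at most [exp (2 s^2 q B |v|^2)]. What remains is the exponential of a squared batch
    sum. *)
Lemma batch_exponential_moment d n (Y : 'I_n -> 'rV[R]_d) (q s : R) B :
  (0 < n)%N -> \sum_j Y j = 0 -> (forall j, mxdot (Y j) (Y j) <= q) ->
  64 * (q * s * B%:R) ^+ 2 <= 1 ->
  \sum_(c : {ffun 'I_B -> 'I_n}) \sum_(c' : {ffun 'I_B -> 'I_n})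
    n%:R^-1 ^+ B * n%:R^-1 ^+ B *
     expR (s * mxdot (\sum_k Y (c k)) (\sum_k Y (c' k)))
  <= expR (4 * (q * s * B%:R) ^+ 2).
Proof.
move=> n0 Y0 Yq h.
have q0 : 0 <= q by apply: le_trans (Yq (Ordinal n0)); exact: mxdot_sqr_ge0.
have nV0 : 0 <= n%:R^-1 :> R by rewrite invr_ge0.
rewrite exchange_big/=.
apply: (@le_trans _ _ (\sum_(c : {ffun 'I_B -> 'I_n}) n%:R^-1 ^+ B *
   expR (2 * s ^+ 2 * q * B%:R * mxdot (\sum_k Y (c k)) (\sum_k Y (c k))))).
  apply: ler_sum => c _; set v := \sum_k Y (c k).
  under eq_bigr do rewrite -mulrA.
  rewrite -mulr_sumr ler_wpM2l ?exprn_ge0//.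
  (* Independence within a batch: a sum over choice functions of a product is the product of the
     sums. *)
  apply: (@le_trans _ _ (\prod_(k < B) \sum_j (n%:R^-1 * expR (s * mxdot (Y j) v)))).
    rewrite bigA_distr_bigA/=; apply: ler_sum => c' _.
    rewrite big_split/= prodr_const card_ord ler_wpM2l ?exprn_ge0//.
    by rewrite mxdot_suml mulr_sumr expR_sum.
  rewrite -mulr_sumr prodr_const card_ord.
  have -> : 2 * s ^+ 2 * q * B%:R * mxdot v v = B%:R * (2 * s ^+ 2 * q * mxdot v v).
    by ring.
  rewrite expRM_natl lerXn2r ?nnegrE ?expR_ge0//.
    by rewrite mulr_ge0// sumr_ge0// => j _; exact: expR_ge0.
  exact: mean_expR_le.
have [->|B0] := posnP B.
  apply: (@le_trans _ _ 1); last by rewrite -expR0 ler_expR mulr0 expr0n mulr0.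
  rewrite (eq_bigr (fun=> 1)) ?sumr_const ?card_ffun ?card_ord //.
  by move=> c _; rewrite expr0 mul1r mulr0 mul0r expR0.
have l0 : 0 <= 2 * s ^+ 2 * q * B%:R.
  by rewrite mulr_ge0// mulr_ge0// pmulr_rge0// sqr_ge0.
(* With [lam = l] and [b = B] the budget condition is an equality; [32 q l B] becomes
   [64 (q s B)^2], and the resulting exponent [2 B l q] is [4 (q s B)^2]. *)
apply: le_trans (mean_expR_sqr_sum_le (B := B) (l := 2 * s ^+ 2 * q * B%:R)
  n0 Y0 Yq _ _ _ _ _) _ => //.
- by apply: le_trans h; rewrite le_eqVlt; apply/orP; left; apply/eqP; ring.
- by rewrite -[_ * B%:R *B%:R]mulrA le_eqVlt; apply/orP; left; apply/eqP; ring.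
- by rewrite le_eqVlt; apply/orP; left; apply/eqP; congr expR; ring.
Qed.

End exponential_moments.

(** * Gaussian matrices *)

Lemma ge0_integral_pushforwardT d1 d2 (X : measurableType d1) (Y : measurableType d2)
    (R : realType) (mu : {measure set X -> \bar R}) (phi : X -> Y) (f : Y -> \bar R) :
  measurable_fun setT phi -> measurable_fun setT f -> (forall y, 0 <= f y)%E ->
  (\int[pushforward mu phi]_y f y = \int[mu]_x f (phi x))%E.
Proof. by move=> mphi mf f0; rewrite ge0_integral_pushforward. Qed.

Lemma ge0_integral_prod d1 d2 (X : measurableType d1) (Y : measurableType d2)
    (R : realType) (mu : {sigma_finite_measure set X -> \bar R})
    (nu : {sigma_finite_measure set Y -> \bar R}) (f : X * Y -> \bar R) :
  measurable_fun setT f -> (forall z, 0 <= f z)%E ->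
  (\int[mu \x nu]_z f z = \int[mu]_x \int[nu]_y f (x, y))%E.
Proof. by move=> mf f0; rewrite fubini_tonelli1. Qed.

(** By uniqueness almost everywhere, [p] agrees with the Radon-Nikodym derivative, for which the
    change of variables is available. *)
Lemma ge0_integral_density d (T : measurableType d) (R : realType)
    (nu : {finite_measure set T -> \bar R})
    (mu : {sigma_finite_measure set T -> \bar R}) (p : T -> R) (f : T -> \bar R) :
  (forall x, 0 <= p x) -> measurable_fun setT p ->
  (forall A, measurable A -> nu A = \int[mu]_(x in A) (p x)%:E)%E ->
  (forall x, 0 <= f x)%E -> measurable_fun setT f ->
  (\int[nu]_x f x = \int[mu]_x (f x * (p x)%:E))%E.
Proof.
move=> p0 mp nuE f0 mf.
have mpE : measurable_fun setT (EFin \o p) by exact/measurable_EFinP.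
have numu : nu `<< mu.
  apply/null_content_dominatesP => A mA muA0; rewrite nuE//.
  by apply: null_set_integral => //; exact: measurable_funTS.
rewrite -(Radon_Nikodym_SigmaFinite.change_of_variables numu)//.
have fi := Radon_Nikodym_SigmaFinite.f_integrable numu.
apply: ae_eq_integral => //.
- by apply: emeasurable_funM => //; exact: measurable_int fi.
- exact: emeasurable_funM.
- apply: ae_eqe_mul2l; apply: integral_ae_eq => // A _ mA.
  by rewrite -Radon_Nikodym_SigmaFinite.f_integral// nuE.
Qed.

Lemma ge0_integral_normal_prob (R : realType) (m s : R) (f : R -> \bar R) :
  (forall x, 0 <= f x)%E -> measurable_fun setT f ->
  (\int[normal_prob m s]_x f x =
   \int[lebesgue_measure]_x (f x * (normal_pdf m s x)%:E))%E.
Proof.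
move=> f0 mf; apply: (@ge0_integral_density _ (measurableTypeR R) R (normal_prob m s)
  lebesgue_measure (normal_pdf m s)) => //.
- by move=> x; exact: normal_pdf_ge0.
- exact: measurable_normal_pdf.
Qed.

Lemma lebesgue_measure_translation (R : realType) (t : R) (A : set R) :
  measurable A ->
  pushforward (@lebesgue_measure R) (fun x : R => x + t : measurableTypeR R) A =
  lebesgue_measure A.
Proof.
move=> mA; apply/esym/lebesgue_measure_unique => [|mt _ [[a b]] _ <-|//].
  exact: measurable_funD.
rewrite /pushforward.
rewrite /= /pushforward.
have -> : (fun x : R => x + t) @^-1` `]a, b]%classic = `]a - t, b - t]%classic.
  by apply/seteqP; split => x /=; rewrite !in_itv/= ltrBlDr lerBrDr.
by rewrite !lebesgue_measure_itv/= !lte_fin ltrD2r -!EFinB opprB addrA subrK.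
Qed.

Lemma ge0_integral_lebesgue_translation (R : realType) (t : R) (f : R -> \bar R) :
  (forall x, 0 <= f x)%E -> measurable_fun setT f ->
  (\int[lebesgue_measure]_x f (x + t)%R = \int[lebesgue_measure]_x f x)%E.
Proof.
move=> f0 mf.
have mt : measurable_fun setT (fun x : R => x + t : measurableTypeR R).
  exact: measurable_funD.
have /= <- := ge0_integral_pushforwardT lebesgue_measure mt mf f0.
by apply: eq_measure_integral => A mA _; exact: lebesgue_measure_translation.
Qed.

(** Cameron-Martin in dimension one: after a translation of Lebesgue measure, the normal density at
    [x - t] is the density at [x] times [exp (t x - t^2 / 2)]. *)
Lemma ge0_integral_normal_translation (R : realType) (t : R) (f : R -> \bar R) :
  (forall x, 0 <= f x)%E -> measurable_fun setT f ->
  (\int[normal_prob 0 1]_x f (x + t)%R =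
   \int[normal_prob 0 1]_x (f x * (expR (t * x - t ^+ 2 / 2)%R)%:E))%E.
Proof.
move=> f0 mf.
have mt : measurable_fun setT (fun x : R => x + t : measurableTypeR R).
  exact: measurable_funD.
have mt' : measurable_fun setT (fun x : R => x - t : R).
  exact: measurable_funD.
have me : measurable_fun setT (fun x => (expR (t * x - t ^+ 2 / 2)%R)%:E).
  apply/measurable_EFinP; apply: measurableT_comp => //.
  by apply: measurable_funB => //; exact: measurable_funM.
rewrite ge0_integral_normal_prob//; last exact: measurableT_comp mf mt.
rewrite ge0_integral_normal_prob//; last 2 first.
- by move=> x; rewrite mule_ge0// lee_fin expR_ge0.
- exact: emeasurable_funM.
pose g x := (f x * (normal_pdf 0 1 (x - t))%:E)%E.
transitivity (\int[lebesgue_measure]_x g (x + t)%R)%E.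
  by apply: eq_integral => x _; rewrite /g addrK.
rewrite ge0_integral_lebesgue_translation//; last 2 first.
- by move=> x; rewrite mule_ge0// lee_fin normal_pdf_ge0.
- apply: emeasurable_funM => //; apply/measurable_EFinP.
  exact: measurableT_comp (measurable_normal_pdf _ _) mt'.
apply: eq_integral => x _; rewrite /g -muleA; congr (_ * _)%E.
rewrite -EFinM; congr EFin; rewrite !normal_pdfE ?oner_eq0// mulrCA; congr (_ * _).
by rewrite /normal_fun -expRD; congr expR; field.
Qed.

(** * Measures on matrices determined by boxes, and the Cameron-Martin formula *)

Section measurable_matrix_theory.
Context {R : realType} {m d : nat}.
Local Notation MM := 'M[R]_(m, d).

Lemma measurable_mx_coord i j : measurable_fun setT (fun X : MM => X i j : R).
Proof.
move=> _ A mA; apply: sub_sigma_algebra; exists (i, j) => //.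
by exists A => //; rewrite setTI.
Qed.

Lemma measurable_fun_mxP d' (T : measurableType d') (f : T -> MM) :
  (forall i j, measurable_fun setT (fun x => f x i j : R)) <-> measurable_fun setT f.
Proof.
split=> [mf|mf i j]; last exact: measurableT_comp (measurable_mx_coord i j) mf.
apply: (@measurability _ _ _ _ setT f
  (\bigcup_(e in [set: 'I_m * 'I_d]) g_sigma_algebra_preimage
        (fun A : MM => A e.1 e.2 : measurableTypeR R))) => //.
move=> _ [_ [[i j] _ [A mA <-]] <-] /=.
by have := mf i j measurableT A mA; rewrite !setTI.
Qed.

Definition mxbox (A : 'I_m -> 'I_d -> set R) : set MM :=
  [set X | forall i j, A i j (X i j)].

Lemma mxboxE A : mxbox A =
  \big[setI/setT]_i \big[setI/setT]_j ((fun X : MM => X i j) @^-1` A i j).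
Proof.
apply/seteqP; split => X.
  move=> AX; rewrite -bigcap_seq => i _; rewrite -bigcap_seq => j _; exact: AX.
rewrite -bigcap_seq => h i j; have := h i (mem_index_enum _).
by rewrite -bigcap_seq => /(_ j (mem_index_enum _)).
Qed.

Lemma measurable_mxbox (A : 'I_m -> 'I_d -> set R) :
  (forall i j, measurable (A i j)) -> measurable (mxbox A).
Proof.
move=> mA; rewrite mxboxE.
apply: bigsetI_measurable => i _; apply: bigsetI_measurable => j _.
by rewrite -[_ @^-1` _]setTI; exact: measurable_mx_coord.
Qed.

(** Boxes are stable under intersection and generate the sigma-algebra, since constraining a single
    entry is already a box. *)
Lemma mx_measure_unique (m1 m2 : {measure set MM -> \bar R}) :
  (m1 setT < +oo)%E ->
  (forall A, (forall i j, measurable (A i j)) -> m1 (mxbox A) = m2 (mxbox A)) ->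
  forall X, measurable X -> m1 X = m2 X.
Proof.
move=> m1oo m12 X mX.
pose G := [set mxbox A | A in [set A | forall i j, measurable (A i j : set R)]].
have GT : G setT.
  by exists (fun _ _ => setT) => //; apply/seteqP; split.
apply: (measure_unique G (fun=> setT)) => //.
- apply/seteqP; split.
  + apply: smallest_sub; first exact: smallest_sigma_algebra.
    move=> _ [[i j] _ [A mA <-]] /=; apply: sub_sigma_algebra.
    exists (fun k l => if (k == i) && (l == j) then A else setT).
      by move=> k l /=; case: ifP.
    rewrite setTI; apply/seteqP; split => Y /=.
      by move=> /(_ i j); rewrite !eqxx.
    by move=> AY k l; case: ifP => // /andP[/eqP -> /eqP ->].
  + apply: smallest_sub; first exact: sigma_algebra_measurable.
    by move=> _ [A mA <-]; exact: measurable_mxbox.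
- move=> _ _ [A mA <-] [B mB <-]; exists (fun i j => A i j `&` B i j).
    by move=> i j; exact: measurableI.
  apply/seteqP; split => Y /=.
    by move=> h; split => i j; have [] := h i j.
  by move=> [hA hB] i j; split.
- by rewrite bigcup_const//; exists 0%N.
- by move=> _ [A mA <-]; exact: m12.
Qed.

Definition mxset (X : MM) i j (y : R) : MM :=
  \matrix_(k, l) if (k == i) && (l == j) then y else X k l.

Lemma measurable_mxset i j :
  measurable_fun setT (fun p : MM * measurableTypeR R => mxset p.1 i j p.2).
Proof.
apply/measurable_fun_mxP => k l.
have [/andP[/eqP -> /eqP ->]|h] := boolP ((k == i) && (l == j)).
  apply: (eq_measurable_fun snd) => // p _.
  by rewrite mxE !eqxx.
apply: (eq_measurable_fun (fun p : MM * R => p.1 k l)) => [p _|].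
  by rewrite mxE (negbTE h).
exact: measurableT_comp (measurable_mx_coord k l) measurable_fst.
Qed.

(** Independent standard normal entries, expressed by the values on boxes; by [mx_measure_unique]
    these determine the law. *)
Definition gaussian_mx (gam : set MM -> \bar R) := forall A : 'I_m -> 'I_d -> set R,
  (forall i j, measurable (A i j)) ->
  gam (mxbox A) = (\prod_i \prod_j normal_prob 0 1 (A i j))%E.

(** Replacing one entry by a fresh standard normal variable preserves the law. This isolates a
    single coordinate and reduces translations to dimension one. *)
Lemma gaussian_mx_resample (gam : probability MM R) i j (phi : MM -> \bar R) :
  gaussian_mx gam -> (forall X, 0 <= phi X)%E -> measurable_fun setT phi ->
  (\int[gam]_X phi X =
   \int[gam]_X \int[normal_prob 0 1]_y phi (mxset X i j y))%E.
Proof.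
move=> gg phi0 mphi.
have ms := measurable_mxset i j.
rewrite -(@ge0_integral_prod _ _ _ _ _ gam (normal_prob 0 1)
  (fun p : MM * measurableTypeR R => phi (mxset p.1 i j p.2)))//;
  [|exact: measurableT_comp mphi ms].
have /= <- := ge0_integral_pushforwardT (gam \x normal_prob 0 1)%E ms mphi phi0.
apply: eq_measure_integral => X mX _; apply: mx_measure_unique => //.
  exact: le_lt_trans (probability_le1 gam measurableT) (ltry 1).
move=> A mA; rewrite [LHS]gg//.
(* The old entry [(i, j)] is overwritten, hence unconstrained; the condition [A i j] falls on the
   fresh variable. *)
pose A' k l := if (k == i) && (l == j) then setT else A k l.
transitivity ((gam \x normal_prob 0 1)%E (mxbox A' `*` A i j)); last first.
  rewrite /= /pushforward; congr ((gam \x normal_prob 0 1)%E _).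
  apply/seteqP; split => -[Y y] /=.
    move=> [AY Ay] k l; rewrite mxE; have := AY k l; rewrite /A'.
    by case: ifP => // /andP[/eqP -> /eqP ->].
  move=> h; split; last by have := h i j; rewrite mxE !eqxx.
  by move=> k l; have := h k l; rewrite mxE /A'; case: ifP.
have mA' k l : measurable (A' k l) by rewrite /A'; case: ifP.
rewrite product_measure1E; [|exact: measurable_mxbox|exact: mA].
transitivity ((\prod_k \prod_l normal_prob 0 1 (A' k l)) * normal_prob 0 1 (A i j))%E;
  last by rewrite -(gg A' mA').
rewrite (bigD1 i)//= (bigD1 j)//= [in RHS](bigD1 i)//= [in RHS](bigD1 j)//=.
rewrite {1}/A' !eqxx/= probability_setT mul1e.
rewrite [RHS]muleC !muleA; congr (_ * _ * _)%E.
  by apply: eq_bigr => l /negbTE lj; rewrite /A' lj andbF.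
by apply: eq_bigr => k /negbTE ki; apply: eq_bigr => l _; rewrite /A' ki.
Qed.

Lemma measurable_mxdot d' (T : measurableType d') (f g : T -> MM) :
  measurable_fun setT f -> measurable_fun setT g ->
  measurable_fun setT (fun x => mxdot (f x) (g x)).
Proof.
move=> /measurable_fun_mxP mf /measurable_fun_mxP mg.
apply: measurable_sum => i; apply: measurable_sum => j.
exact: measurable_funM.
Qed.

Lemma gaussian_mx_translation_coord (gam : probability MM R) i j (t : R) (phi : MM -> \bar R) :
  gaussian_mx gam -> (forall X, 0 <= phi X)%E -> measurable_fun setT phi ->
  (\int[gam]_X phi (X + t *: delta_mx i j)%R =
   \int[gam]_X (phi X * (expR (t * X i j - t ^+ 2 / 2)%R)%:E))%E.
Proof.
move=> gg phi0 mphi.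
have mD : measurable_fun setT (fun X : MM => X + t *: delta_mx i j).
  apply/measurable_fun_mxP => k l.
  apply: (eq_measurable_fun (fun X : MM => X k l + t * (delta_mx i j : MM) k l)).
    by move=> X _; rewrite !mxE.
  by apply: measurable_funD => //; exact: measurable_mx_coord.
rewrite (gaussian_mx_resample i j gg)//; last exact: measurableT_comp mphi mD.
rewrite [RHS](gaussian_mx_resample i j gg)//; last 2 first.
- by move=> X; rewrite mule_ge0// lee_fin expR_ge0.
- apply: emeasurable_funM => //; apply/measurable_EFinP.
  apply: measurableT_comp => //; apply: measurable_funB => //.
  by apply: measurable_funM => //; exact: measurable_mx_coord.
apply: eq_integral => X _.
pose f y := phi (mxset X i j y).
transitivity (\int[normal_prob 0 1]_y f (y + t)%R)%E.
  apply: eq_integral => y _; congr phi; apply/matrixP => k l; rewrite !mxE.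
  by case: andP => _; rewrite ?mulr1 ?mulr0 ?addr0.
rewrite ge0_integral_normal_translation; last 2 first.
- by move=> y; exact: phi0.
- apply: measurableT_comp => //.
  exact: (measurableT_comp (measurable_mxset i j) (measurable_pair1 X)).
by apply: eq_integral => y _; rewrite mxE !eqxx.
Qed.

(** Cameron-Martin for matrices, shifting one entry at a time along a list of positions. *)
Lemma gaussian_mx_translation (gam : probability MM R) (U : MM) (phi : MM -> \bar R) :
  gaussian_mx gam -> (forall X, 0 <= phi X)%E -> measurable_fun setT phi ->
  (\int[gam]_X phi (X + U)%R =
   \int[gam]_X (phi X * (expR (mxdot U X - mxdot U U / 2)%R)%:E))%E.
Proof.
move=> gg phi0 mphi.
suff H (r : seq ('I_m * 'I_d)) (f : MM -> \bar R) : uniq r ->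
    (forall X, 0 <= f X)%E -> measurable_fun setT f ->
    (\int[gam]_X f (X + \sum_(p <- r) U p.1 p.2 *: delta_mx p.1 p.2)%R =
     \int[gam]_X (f X *
       (expR (\sum_(p <- r) (U p.1 p.2 * X p.1 p.2 - U p.1 p.2 ^+ 2 / 2))%R)%:E))%E.
  have := H (index_enum _) phi (index_enum_uniq _) phi0 mphi.
  rewrite -(pair_bigA _ (fun i j => U i j *: delta_mx i j))/= -matrix_sum_delta => ->.
  apply: eq_integral => X _; congr (_ * (expR _)%:E)%E.
  rewrite -(pair_bigA _ (fun i j => U i j * X i j - U i j ^+ 2 / 2))/=.
  rewrite /mxdot mulr_suml -sumrB; apply: eq_bigr => i _.
  by rewrite mulr_suml -sumrB; apply: eq_bigr => j _; rewrite expr2.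
elim: r f => [|[i j] r ih] f /=.
  move=> _ f0 mf; apply: eq_integral => X _.
  by rewrite !big_nil addr0 expR0 mule1.
move=> /andP[pr ur] f0 mf.
pose S : MM := \sum_(p <- r) U p.1 p.2 *: delta_mx p.1 p.2.
(* As positions do not repeat, the remaining shifts leave entry [(i, j)] alone, so the weight
   already produced for it is unaffected by them. *)
have S0 : S i j = 0.
  rewrite /S summxE big_seq big1// => p pr'; rewrite !mxE.
  case: andP => [[/eqP ip /eqP jp]|_]; last by rewrite mulr0.
  by move: pr; rewrite ip jp; case: (p) pr' => /= a b ->.
have mS : measurable_fun setT (fun X : MM => X + S).
  apply/measurable_fun_mxP => k l.
  apply: (eq_measurable_fun (fun X : MM => X k l + S k l)); first by move=> X _; rewrite mxE.
  by apply: measurable_funD => //; exact: measurable_mx_coord.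
pose f' X := (f X * (expR (U i j * X i j - U i j ^+ 2 / 2)%R)%:E)%E.
transitivity (\int[gam]_X f' (X + S)%R)%E.
  transitivity (\int[gam]_X (fun Y => f (Y + S)%R) (X + U i j *: delta_mx i j)%R)%E.
    by apply: eq_integral => X _; rewrite big_cons/= addrA.
  rewrite (gaussian_mx_translation_coord i j (U i j) (phi := fun Y => f (Y + S)) gg)//;
    last exact: measurableT_comp mf mS.
  by apply: eq_integral => X _; rewrite /f' mxE S0 addr0.
rewrite ih//; last 2 first.
- by move=> X; rewrite mule_ge0// lee_fin expR_ge0.
- apply: emeasurable_funM => //; apply/measurable_EFinP.
  apply: measurableT_comp => //; apply: measurable_funB => //.
  by apply: measurable_funM => //; exact: measurable_mx_coord.
by apply: eq_integral => X _; rewrite /f' big_cons/= -muleA -EFinM -expRD.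
Qed.

Lemma gaussian_mx_expR (gam : probability MM R) (U : MM) : gaussian_mx gam ->
  (\int[gam]_X (expR (mxdot U X - mxdot U U / 2)%R)%:E = 1)%E.
Proof.
move=> gg.
have := @gaussian_mx_translation gam U (cst 1%E) gg (fun=> lee01) (measurable_cst _).
rewrite integral_cst//= probability_setT mule1 => ->.
by apply: eq_integral => X _; rewrite mul1e.
Qed.

End measurable_matrix_theory.

(** * Processes driven by independent noise *)

Lemma measure_fiber_sum d (T : measurableType d) (R : realType) (A : finType)
    (mu : {measure set T -> \bar R}) (J : T -> A) (D : set T) :
  (forall a, measurable (D `&` J @^-1` [set a])) ->
  mu D = (\sum_a mu (D `&` J @^-1` [set a]))%E.
Proof.
move=> mDJ.
suff H (s : seq A) : uniq s ->
    measurable (D `&` [set x | J x \in s]) /\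
    mu (D `&` [set x | J x \in s]) = (\sum_(a <- s) mu (D `&` J @^-1` [set a]))%E.
  have [_ <-] := H _ (index_enum_uniq A); congr (mu _); apply/seteqP; split=> [x Dx|x []//].
  by split => //=; exact: mem_index_enum.
elim: s => [_|a s ih /= /andP[aNs us]].
  rewrite big_nil (_ : _ `&` _ = set0) ?measure0//.
  by apply/seteqP; split => x // [].
have [ms mus] := ih us.
have -> : D `&` [set x | J x \in a :: s] =
    (D `&` J @^-1` [set a]) `|` (D `&` [set x | J x \in s]).
  rewrite -setIUr; congr (_ `&` _); apply/seteqP; split => x /=; rewrite inE.
    by move=> /orP[/eqP ?|?]; [left|right].
  by move=> [->|->]; rewrite ?eqxx ?orbT.
split; first exact: measurableU.
rewrite big_cons -mus; apply: measureU => //.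
apply/seteqP; split => x // [[_ /= Ja] [_ Js]].
by rewrite -Ja Js in aNs.
Qed.

Section joint_law.
Context {R : realType} {dT dS} {T : measurableType dT} {S : measurableType dS}.
Context {m d : nat} (P : probability T R) (U : {mfun T >-> S})
  (E : {mfun T >-> 'M[R]_(m, d)}) (gam : probability 'M[R]_(m, d) R).

Lemma measurable_pair_mfun : measurable_fun setT (fun w => (U w, E w)).
Proof. by apply: measurable_fun_pair; exact: measurable_funPT. Qed.

(** Two extensions by uniqueness of measures: for a fixed event on [U], from boxes to all events on
    [E]; then from rectangles to all events on the pair. Restriction to [D] and scaling by constants
    turn both sides into measures. *)
Lemma joint_law (D : set T) : measurable D ->
  (forall X B, measurable X -> (forall i j, measurable (B i j)) ->
    P (U @^-1` X `&` (E @^-1` mxbox B `&` D)) =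
    P (U @^-1` X) * (gam (mxbox B) * P D))%E ->
  forall Z, measurable Z ->
  P ((fun w => (U w, E w)) @^-1` Z `&` D) =
  (P D * (distribution P U \x gam) Z)%E.
Proof.
move=> mD ind Z mZ.
have mUX X : measurable X -> measurable (U @^-1` X).
  by move=> mX; rewrite -[_ @^-1` _]setTI; exact: measurable_funPT.
have fP B : measurable B -> ((fine (P B))%:E = P B)%E.
  by move=> mB; rewrite fineK// fin_num_measure.
have step X B : measurable X -> measurable B ->
    P (U @^-1` X `&` (E @^-1` B `&` D)) = (P (U @^-1` X) * (gam B * P D))%E.
  move=> mX mB.
  have mXD : measurable (U @^-1` X `&` D) by apply: measurableI => //; exact: mUX.
  have c0 : (0 <= fine (P (U @^-1` X) * P D)%E)%R by rewrite fine_ge0// mule_ge0.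
  transitivity (pushforward (mrestr P mXD) E B).
    by rewrite /pushforward /mrestr setICA.
  transitivity (mscale (NngNum c0) gam B); last first.
    rewrite /mscale/= fineK; last by rewrite fin_numM// fin_num_measure//; exact: mUX.
    by rewrite muleAC muleA.
  apply: mx_measure_unique => //.
  - rewrite /= /pushforward /mrestr preimage_setT setTI.
    exact: le_lt_trans (probability_le1 P mXD) (ltry 1).
  - move=> A mA; rewrite /= /pushforward /mrestr /mscale/= setICA ind//.
    rewrite fineK; last by rewrite fin_numM// fin_num_measure//; exact: mUX.
    by rewrite muleAC muleA.
have c0 : (0 <= fine (P D))%R by rewrite fine_ge0.
transitivity (pushforward (mrestr P mD) (fun w => (U w, E w)) Z) => //.
transitivity (mscale (NngNum c0) (distribution P U \x gam)%E Z); last first.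
  by rewrite /mscale/= fP.
have mUE := measurable_pair_mfun.
pose G : set (set (S * 'M[R]_(m, d))) :=
  [set A `*` B | A in measurable & B in measurable].
apply: (measure_unique G (fun=> setT)) => //.
- by rewrite measurable_prod_measurableType.
- move=> _ _ [A mA [B mB <-]] [A' mA' [B' mB' <-]]; rewrite -setXI.
  exists (A `&` A'); first exact: measurableI.
  by exists (B `&` B') => //; exact: measurableI.
- by move=> _; exists setT => //; exists setT => //; rewrite setXTT.
- by rewrite bigcup_const//; exists 0%N.
- move=> _ [A mA [B mB <-]]; rewrite /= /mscale/= fP//.
  rewrite product_measure1E// /pushforward /mrestr.
  rewrite -[LHS]/(P ((U @^-1` A `&` E @^-1` B) `&` D)) -setIA step//.
  by rewrite muleA muleC.
- move=> _; rewrite /= /pushforward /mrestr preimage_setT setTI.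
  exact: le_lt_trans (probability_le1 P mD) (ltry 1).
Qed.

Lemma ge0_integral_joint_law (D : set T) (f : S * 'M[R]_(m, d) -> \bar R) : measurable D ->
  (forall X B, measurable X -> (forall i j, measurable (B i j)) ->
    P (U @^-1` X `&` (E @^-1` mxbox B `&` D)) =
    P (U @^-1` X) * (gam (mxbox B) * P D))%E ->
  measurable_fun setT f -> (forall z, 0 <= f z)%E ->
  (\int[P]_(x in D) f (U x, E x) =
   P D * \int[distribution P U]_s \int[gam]_e f (s, e))%E.
Proof.
move=> mD ind mf f0.
have mUE := measurable_pair_mfun.
have mfUE : measurable_fun setT (fun x => f (U x, E x)) by exact: measurableT_comp mf mUE.
transitivity (\int[mrestr P mD]_(x in D) f (U x, E x))%E.
  by apply: eq_measure_integral => A mA AD; rewrite /= /mrestr setIidl.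
transitivity (\int[mrestr P mD]_x f (U x, E x))%E.
  rewrite [RHS](@ge0_negligible_integral _ _ _ _ setT (~` D))//; first by rewrite setDE setTI setCK.
  - exact: measurableC.
  - by rewrite /= /mrestr setICl measure0.
have /= <- := ge0_integral_pushforwardT (mrestr P mD) mUE mf f0.
have c0 : (0 <= fine (P D))%R by rewrite fine_ge0.
transitivity (\int[mscale (NngNum c0) (distribution P U \x gam)%E]_z f z)%E.
  apply: eq_measure_integral => Z mZ _.
  rewrite [LHS]joint_law//.
  by rewrite /= /mscale/= fineK// fin_num_measure.
rewrite ge0_integral_mscale//= ge0_integral_prod// fineK//.
exact: fin_num_measure.
Qed.

End joint_law.

(* [future k] stands for the events generated by the randomness used from step [k] on. *)
Section driven_process.
Context {R : realType} {dT dS} {T : measurableType dT} {S : measurableType dS}.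
Context {m d : nat} {A : finType} (P : probability T R).
Variables (gam : probability 'M[R]_(m, d) R) (w : R).
Variables (U : nat -> {mfun T >-> S}) (E : nat -> {mfun T >-> 'M[R]_(m, d)}).
Variables (J : nat -> T -> A) (psi : nat -> A -> S * 'M[R]_(m, d) -> S).
Variable future : nat -> set_system T.
Hypothesis mpsi : forall k a, measurable_fun setT (psi k a).
Hypothesis UE : forall k x, U k.+1 x = psi k (J k x) (U k x, E k x).
Hypothesis future_setT : forall k, future k setT.
Hypothesis measurable_future : forall k C, future k C -> measurable C.
Hypothesis future_step : forall k C a B, (forall i j, measurable (B i j)) ->
  future k.+1 C ->
  let D := E k @^-1` mxbox B `&` (J k @^-1` [set a] `&` C) in
  future k D /\ P D = (gam (mxbox B) * (w%:E * P C))%E.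
Hypothesis independent_start : forall X C, measurable X -> future 0 C ->
  P (U 0%N @^-1` X `&` C) = (P (U 0%N @^-1` X) * P C)%E.

Let mxboxT : mxbox (fun _ _ => setT) = [set: 'M[R]_(m, d)].
Proof. by apply/seteqP; split. Qed.

Let future_batch k C a : future k.+1 C ->
  future k (J k @^-1` [set a] `&` C) /\ P (J k @^-1` [set a] `&` C) = (w%:E * P C)%E.
Proof.
move=> fC; have [] := future_step a (B := fun _ _ => setT) (fun _ _ => measurableT) fC.
by rewrite mxboxT preimage_setT setTI probability_setT mul1e.
Qed.

Let joint k C a : (forall X C, measurable X -> future k C ->
    P (U k @^-1` X `&` C) = (P (U k @^-1` X) * P C)%E) ->
  future k.+1 C -> forall X B, measurable X -> (forall i j, measurable (B i j)) ->
  P (U k @^-1` X `&` (E k @^-1` mxbox B `&` (J k @^-1` [set a] `&` C))) =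
  (P (U k @^-1` X) * (gam (mxbox B) * P (J k @^-1` [set a] `&` C)))%E.
Proof.
move=> ind fC X B mX mB; have [fD PD] := future_step a mB fC.
by rewrite ind// PD; have [_ ->] := future_batch a fC.
Qed.

(** On each fibre of [J k], the next state is a function of the pair [(U k, E k)]. By induction
    [U k] is independent of the noise, the batch and the later events taken together. *)
Lemma driven_process_independent k X C : measurable X -> future k C ->
  P (U k @^-1` X `&` C) = (P (U k @^-1` X) * P C)%E.
Proof.
elim: k X C => [|k ih] X C mX fC; first exact: independent_start.
have mpX a : measurable (psi k a @^-1` X).
  by rewrite -[_ @^-1` _]setTI; exact: mpsi.
(* The first factor does not depend on [C'], so the choice [C' = setT] identifies it as the
   probability of the event on [U k.+1]. *)
have H C' : future k.+1 C' -> P (U k.+1 @^-1` X `&` C') =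
    ((w%:E * \sum_a (distribution P (U k) \x gam) (psi k a @^-1` X)) * P C')%E.
  move=> fC'.
  have mC' := measurable_future fC'.
  have mJC a := measurable_future (future_batch a fC').1.
  have eqa a : U k.+1 @^-1` X `&` C' `&` J k @^-1` [set a] =
      (fun x => (U k x, E k x)) @^-1` (psi k a @^-1` X) `&` (J k @^-1` [set a] `&` C').
    apply/seteqP; split => x /=.
      by move=> [[UX Cx] Ja]; rewrite -Ja -UE.
    by move=> [UX [Ja Cx]]; rewrite UE Ja.
  have mUC : measurable (U k.+1 @^-1` X).
    by rewrite -[_ @^-1` _]setTI; exact: measurable_funPT.
  rewrite (@measure_fiber_sum _ _ _ _ P (J k)); last first.
    by move=> a; rewrite -setIA (setIC C'); exact: measurableI.
  rewrite -muleA muleC -muleA ge0_sume_distrl; last by [].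
  apply: eq_bigr => a _; rewrite eqa.
  have [_ PJ] := future_batch a fC'.
  rewrite (muleC (P C')) -PJ muleC.
  apply: (@joint_law _ _ _ _ _ _ _ P (U k) (E k) gam _ (mJC a)) => //.
  by move=> Y B; exact: joint.
have := H _ (future_setT k.+1); rewrite setIT probability_setT mule1 => ->.
exact: H.
Qed.

(** The Markov transition written on laws alone, so that no conditional expectation or kernel is
    needed later. *)
Lemma driven_process_step k (h : S -> \bar R) :
  measurable_fun setT h -> (forall s, 0 <= h s)%E ->
  (\int[distribution P (U k.+1)]_s h s =
   w%:E * \sum_a \int[distribution P (U k)]_s \int[gam]_e h (psi k a (s, e)))%E.
Proof.
move=> mh h0.
have fT := future_setT k.+1.
have mJ a : measurable (J k @^-1` [set a]).
  by have [/measurable_future] := future_batch a fT; rewrite setIT.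
have PJ a : P (J k @^-1` [set a]) = w%:E.
  by have [_] := future_batch a fT; rewrite setIT probability_setT mule1.
rewrite ge0_integral_distribution//.
have mhU : measurable_fun setT (h \o U k.+1).
  exact: measurableT_comp mh (measurable_funPT _).
transitivity (\int[P]_x \sum_a ((h \o U k.+1) \_ (J k @^-1` [set a])) x)%E.
  apply: eq_integral => x _; rewrite (bigD1 (J k x))//= big1.
    by rewrite adde0 patchE mem_set.
  move=> a /negP ax; rewrite patchE memNset//= => /eqP.
  by rewrite eq_sym => /ax.
rewrite ge0_integral_sum//; last 2 first.
- move=> a; exact/(measurable_restrictT _ (mJ a)).1/(measurable_funS measurableT).
- by move=> a x _; rewrite patchE; case: ifP => _ //=; exact: h0.
rewrite ge0_sume_distrr; last first.
  by move=> a _; apply: integral_ge0 => s _; apply: integral_ge0 => e _.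
apply: eq_bigr => a _; rewrite -integral_mkcond -(PJ a).
rewrite -(@ge0_integral_joint_law _ _ _ _ _ _ _ P (U k) (E k) gam _ (h \o psi k a) (mJ a))//.
- apply: eq_integral => x; rewrite inE /= => Ja.
  by rewrite UE Ja.
- move=> X B mX mB.
  have := joint a (fun X C mX fC => driven_process_independent mX fC) fT mX mB.
  by rewrite setIT.
- exact: measurableT_comp mh (mpsi k a).
- by move=> z; exact: h0.
Qed.

End driven_process.

(** * Relative entropy and likelihood ratios *)

Lemma measurable_fun_truncation d (T : measurableType d) (R : realType) (f : T -> R) (a : R) :
  measurable_fun setT f -> measurable_fun setT (fun x => Num.min (f x) a) /\
  measurable_fun setT (fun x => Num.max (f x) a).
Proof.
move=> mf; split.
  apply: (measurableT_comp (f := fun y : R => Num.min y a)) => //.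
  by apply: nondecreasing_measurable => // x y xy; rewrite le_min !ge_min xy lexx orbT.
apply: (measurableT_comp (f := fun y : R => Num.max y a)) => //.
by apply: nondecreasing_measurable => // x y xy; rewrite ge_max !le_max xy lexx orbT.
Qed.

Section kullback_leibler_bound.
Context {R : realType} {d} {T : measurableType d} (mu nu : probability T R) (r : R).

(* By homogeneity in [h] this says [(\int h dmu)^2 <= e^r \int h^2 dnu], i.e. that
   the chi-square divergence of [mu] from [nu] is at most [e^r - 1]. *)
Hypothesis dual_bound : forall h : T -> R, measurable_fun setT h -> (forall x, 0 <= h x) ->
  (2%:E * \int[mu]_x (h x)%:E <= (expR r)%:E + \int[nu]_x (h x ^+ 2)%:E)%E.

(** On a [nu]-null set [A] the test function [t * \1_A] gives [2 t mu(A) <= e^r] for every [t >= 0].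
    The choice [t = e^r / mu(A)] is contradictory. *)
Lemma dual_bound_dominates : mu `<< nu.
Proof.
apply/null_content_dominatesP => A mA nuA0.
suff : (mu A <= 0)%E by move=> h; apply/eqP; rewrite eq_le h measure_ge0.
have muA := fineK (fin_num_measure mu _ mA).
rewrite -muA lee_fin leNgt; apply/negP => m0.
pose t := expR r / fine (mu A).
have t0 : 0 < t by rewrite divr_gt0// expR_gt0.
have mh : measurable_fun setT (fun x => t * \1_A x : R).
  by apply: measurable_funM => //; exact: measurable_indic.
have := dual_bound mh; rewrite leNgt => /(_ _)/negP; apply.
  by move=> x; rewrite mulr_ge0// ltW.
have -> : (\int[nu]_x ((t * \1_A x) ^+ 2)%:E = 0)%E.
  rewrite (eq_integral (fun x => (t ^+ 2)%:E * (\1_A x)%:E))%E; last first.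
    move=> x _; rewrite -EFinM exprMn; congr (EFin (_ * _)).
    by rewrite indicE; case: (_ \in _); rewrite ?expr1n ?expr0n.
  rewrite ge0_integralZl_EFin ?sqr_ge0//; last exact/measurable_EFinP/measurable_indic.
  by rewrite integral_indic// setIT [X in (_ * X)%E]nuA0 mule0.
under eq_integral do rewrite EFinM.
rewrite ge0_integralZl_EFin ?(ltW t0)//; last exact/measurable_EFinP/measurable_indic.
have -> : (\int[mu]_x (\1_A x)%:E = (fine (mu A))%:E)%E by rewrite muA integral_indic// setIT.
rewrite adde0 -!EFinM lte_fin /t divfK ?gt_eqF//.
by rewrite mulr_natl mulr2n ltrDl expR_gt0.
Qed.

Local Open Scope charge_scope.
Let D := 'd (charge_of_finite_measure mu) '/d nu.
(** The derivative of a charge has no pointwise sign, while test functions must be nonnegative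
    everywhere; hence the positive part. *)
Let f x := Num.max (fine (D x)) 0.

Let mD : measurable_fun setT D.
Proof.
exact: measurable_int
  (Radon_Nikodym_integrable (nu := charge_of_finite_measure mu) dual_bound_dominates).
Qed.

Let D_fin x : D x = (fine (D x))%:E.
Proof. by rewrite fineK// Radon_Nikodym_fin_num//; exact: dual_bound_dominates. Qed.

Let mfD : measurable_fun setT (fine \o D).
Proof. by apply: measurableT_comp => //; exact: fine_measurable. Qed.

Let mf : measurable_fun setT f.
Proof. exact: (measurable_fun_truncation 0 mfD).2. Qed.

Let f0 x : 0 <= f x. Proof. by rewrite le_max lexx orbT. Qed.

(** For [h = min (f, N)] one has [h^2 <= h D], so [\int h^2 dnu <= \int h dmu], and the dual bound
    leaves [\int h dmu <= e^r]. Truncation keeps this integral finite, so that it can be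
    subtracted. *)
Let truncated_integral_le N :
  (\int[mu]_x (Num.min (f x) N%:R)%:E <= (expR r)%:E)%E.
Proof.
pose h x := Num.min (f x) N%:R.
have mh : measurable_fun setT h by exact: (measurable_fun_truncation _ mf).1.
have h0 x : 0 <= h x by rewrite le_min f0 ler0n.
have hN x : h x <= N%:R by rewrite ge_min lexx orbT.
have ih : mu.-integrable setT (EFin \o h).
  apply: (le_integrable measurableT (g := cst N%:R%:E)).
  - exact/measurable_EFinP.
  - by move=> x _; rewrite /= lee_fin !ger0_norm.
  - exact: finite_measure_integrable_cst.
have fin : (\int[mu]_x (h x)%:E)%E \is a fin_num by exact: integrable_fin_num.
have := dual_bound mh h0.
have : (\int[nu]_x (h x ^+ 2)%:E <= \int[mu]_x (h x)%:E)%E.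
  rewrite -(Radon_Nikodym_change_of_variables dual_bound_dominates measurableT ih).
  apply: ge0_le_integral => //.
  - by move=> x _; rewrite lee_fin sqr_ge0.
  - by apply/measurable_EFinP; exact: measurable_funX.
  - by apply: emeasurable_funM => //; exact/measurable_EFinP.
  - move=> x _; rewrite -/D /= D_fin -EFinM lee_fin expr2.
    have [Dx|Dx] := leP (fine (D x)) 0.
      suff -> : h x = 0 by rewrite !mul0r.
      by apply/eqP; rewrite eq_le h0 andbT /h /f max_r// ge_min lexx.
    by rewrite ler_wpM2l// /h /f max_l ?(ltW Dx)// ge_min lexx.
rewrite -(fineK fin).
move: (fine _) (\int[nu]_x _)%E => a [b| |]//=; rewrite -?EFinM -?EFinD ?lee_fin//; lra.
Qed.

Let integral_f_le : (\int[mu]_x (f x)%:E <= (expR r)%:E)%E.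
Proof.
pose g (N : nat) x := (Num.min (f x) N%:R)%:E.
have mg N : measurable_fun setT (g N).
  by apply/measurable_EFinP; exact: (measurable_fun_truncation _ mf).1.
have g0 N x : setT x -> (0 <= g N x)%E.
  by move=> _; rewrite lee_fin le_min f0 ler0n.
have ndg x : setT x -> nondecreasing_seq (g^~ x).
  move=> _ a b ab; rewrite lee_fin le_min ge_min lexx/=.
  by rewrite ge_min ler_nat ab orbT.
rewrite (eq_integral (fun x => limn (g^~ x))); last first.
  move=> x _; apply/esym/cvg_lim => //; apply: cvg_near_cst.
  near=> N; rewrite /g min_l//.
  by near: N; exact: nbhs_infty_ger.
rewrite monotone_convergence//.
apply: lime_le.
  apply: ereal_nondecreasing_is_cvgn => a b ab.
  by apply: ge0_le_integral => // x _; [exact: g0|exact: ndg].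
by apply: nearW => N; exact: truncated_integral_le.
Unshelve. all: by end_near. Qed.

Lemma KL_le : (KL mu nu <= r%:E)%E.
Proof.
have dom := dual_bound_dominates.
rewrite /KL asboolT// -/D.
(* Jensen's inequality by a tangent line: [g] is the tangent of the logarithm at [e^r], evaluated at
   [f x], and its [mu]-integral is at most [1 + (r - 1)]. *)
pose g x := f x * expR (- r) + (r - 1).
have mfE : measurable_fun setT (EFin \o f) by exact/measurable_EFinP.
have if_ : mu.-integrable setT (EFin \o f).
  apply/integrableP; split => //.
  rewrite (eq_integral (EFin \o f)); last by move=> x _ /=; rewrite ger0_norm.
  exact: le_lt_trans integral_f_le (ltry _).
have ig : mu.-integrable setT (EFin \o g).
  rewrite (_ : EFin \o g = (fun x => (f x)%:E * (expR (- r))%:E) \+ cst (r - 1)%:E)%E//.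
  apply: integrableD => //; first exact: integrableZr.
  exact: finite_measure_integrable_cst.
have lg x : (lne (D x) <= (g x)%:E)%E.
  rewrite D_fin; have [D0|D0] := leP (fine (D x)) 0; first by rewrite le0_lneNy ?leNye ?lee_fin.
  rewrite lne_EFin// lee_fin /g /f max_l ?(ltW D0)//.
  have -> : fine (D x) = expR (ln (fine (D x))) by rewrite lnK.
  rewrite expRK -expRD; have := expR_ge1Dx (ln (fine (D x)) - r); lra.
have ml : measurable_fun setT (fun x => lne (D x)).
  apply: (eq_measurable_fun (fun x => if fine (D x) <= 0 then -oo%E else (ln (fine (D x)))%:E)).
    move=> x _ /=; rewrite [in RHS]D_fin; case: leP => D0; first by rewrite le0_lneNy ?lee_fin.
    by rewrite lne_EFin.
  apply: measurable_fun_ifT => //.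
  - exact: measurable_fun_ler.
  - by apply/measurable_EFinP; exact: measurableT_comp.
(* The logarithm may take the value [-oo] and is not known to be integrable, so positive and
   negative parts are compared separately. *)
apply: (@le_trans _ _ (\int[mu]_x (g x)%:E)%E).
  have mgE := measurable_int _ ig.
  rewrite integralE [leRHS]integralE leeB//.
  - apply: ge0_le_integral => //; [exact: measurable_funepos|exact: measurable_funepos|].
    by move=> x /mem_set; apply: funepos_le => y _; exact: lg.
  - apply: ge0_le_integral => //; [exact: measurable_funeneg|exact: measurable_funeneg|].
    by move=> x /mem_set; apply: funeneg_le => y _; exact: lg.
rewrite (eq_integral (fun x => (f x)%:E * (expR (- r))%:E + (r - 1)%:E)%E)//.
rewrite integralD//; [|exact: integrableZr|exact: finite_measure_integrable_cst].
rewrite integralZr// integral_cst//= probability_setT mule1.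
have fin : (\int[mu]_x (f x)%:E)%E \is a fin_num by exact: integrable_fin_num.
move: integral_f_le; rewrite -(fineK fin) lee_fin -EFinM -EFinD lee_fin => h.
have : fine (\int[mu]_x (f x)%:E)%E * expR (- r) <= 1.
  by rewrite expRN ler_pdivrMr ?expR_gt0// mul1r.
lra.
Qed.

End kullback_leibler_bound.

(** * Likelihood ratio along a path: density property and second moment *)

Section likelihood_ratio.
Context {R : realType} {dS} {S : measurableType dS} {m d : nat} {A : finType}.
Variables (gam : probability 'M[R]_(m, d) R) (w r : R) (K : nat).
Variables (mu nu : nat -> probability S R) (phi : nat -> S * 'M[R]_(m, d) -> S).
Variables (u : nat -> A -> S -> 'M[R]_(m, d)) (G : nat -> set S) (L : nat -> S -> R).
Hypothesis gam_gaussian : gaussian_mx gam.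
Hypothesis w0 : 0 <= w.
Hypothesis mphi : forall k, measurable_fun setT (phi k).
Hypothesis m_u : forall k a, measurable_fun setT (u k a).
Hypothesis mG : forall k, measurable (G k).
Hypothesis mL : forall k, measurable_fun setT (L k).
Hypothesis L0 : forall k s, 0 <= L k s.
Hypothesis Lstart : forall s, L 0%N s = 1.
Hypothesis Lstep : forall k s e, (k < K)%N -> L k.+1 (phi k (s, e)) =
  L k s * (\1_(G k) s * (w * \sum_a expR (mxdot (u k a s) e - mxdot (u k a s) (u k a s) / 2))).
Hypothesis start : forall X, measurable X -> mu 0%N X = nu 0%N X.
Hypothesis nu_step : forall k (h : S -> \bar R), measurable_fun setT h -> (forall s, 0 <= h s)%E ->
  (\int[nu k.+1]_s h s = \int[nu k]_s \int[gam]_e h (phi k (s, e)))%E.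
Hypothesis mu_step : forall k (h : S -> \bar R), measurable_fun setT h -> (forall s, 0 <= h s)%E ->
  (\int[mu k.+1]_s h s =
   w%:E * \sum_a \int[mu k]_s \int[gam]_e h (phi k (s, e + u k a s)%R))%E.
Hypothesis muG : forall k, (k < K)%N -> mu k (~` G k) = 0%E.
Hypothesis moment : forall k s, G k s ->
  \sum_a \sum_b w * w * expR (mxdot (u k a s) (u k b s)) <= expR r.

Let weight k a s e := expR (mxdot (u k a s) e - mxdot (u k a s) (u k a s) / 2).

Let weight_ge0 k a s e : 0 <= weight k a s e. Proof. exact: expR_ge0. Qed.

Let measurable_weight k a : measurable_fun setT (fun z : S * 'M[R]_(m, d) => weight k a z.1 z.2).
Proof.
apply: measurableT_comp => //.
have mu1 : measurable_fun setT (fun z : S * 'M[R]_(m, d) => u k a z.1).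
  exact: measurableT_comp.
by apply: measurable_funB; [|apply: measurable_funM => //]; exact: measurable_mxdot.
Qed.

(** Cameron-Martin converts the shift of the noise into a weight, so each step multiplies the
    density by the mixture of these weights. *)
Lemma likelihood_ratio_density k (h : S -> \bar R) : (k <= K)%N ->
  measurable_fun setT h -> (forall s, 0 <= h s)%E ->
  (\int[mu k]_s h s = \int[nu k]_s (h s * (L k s)%:E))%E.
Proof.
elim: k h => [|k ih] h kK mh h0.
  transitivity (\int[nu 0%N]_s h s)%E.
    by apply: eq_measure_integral => X mX _; first [exact: start | exact/esym/start].
  by apply: eq_integral => s _; rewrite Lstart mule1.
pose H a s := (\int[gam]_e (h (phi k (s, e)) * (weight k a s e)%:E))%E.
have mhphi : measurable_fun setT (h \o phi k) by exact: measurableT_comp.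
have mhw a : measurable_fun setT
    (fun z : S * 'M[R]_(m, d) => h (phi k z) * (weight k a z.1 z.2)%:E)%E.
  by apply: emeasurable_funM => //; apply/measurable_EFinP; exact: measurable_weight.
have mH a : measurable_fun setT (H a).
  apply: (@measurable_fun_fubini_tonelli_F _ _ _ _ _ gam _ (mhw a)) => z.
  by rewrite mule_ge0// lee_fin.
have H0 a s : (0 <= H a s)%E.
  by apply: integral_ge0 => e _; rewrite mule_ge0// lee_fin.
have mGe : measurable_fun setT (fun s => (\1_(G k) s)%:E : \bar R).
  by apply/measurable_EFinP; exact: measurable_indic.
have msumH : measurable_fun setT (fun s => \sum_a H a s)%E by exact: emeasurable_sum.
have sumH0 s : (0 <= \sum_a H a s)%E by exact: sume_ge0.
rewrite mu_step//.
transitivity (\int[mu k]_s (w%:E * \sum_a H a s))%E.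
  rewrite ge0_integralZl_EFin//; congr (_ * _)%E.
  rewrite ge0_integral_sum//; apply: eq_bigr => a _; apply: eq_integral => s _.
  have := @gaussian_mx_translation _ _ _ gam (u k a s) (fun e => h (phi k (s, e))) gam_gaussian.
  by apply => //; exact: measurableT_comp mhphi (measurable_pair1 s).
(* The indicator must enter while the integral is still against [mu k], the law that gives the
   complement of [G k] measure zero. *)
transitivity (\int[mu k]_s ((\1_(G k) s)%:E * (w%:E * \sum_a H a s)))%E.
  apply: ge0_ae_eq_integral => //.
  - exact: emeasurable_funM.
  - by apply: emeasurable_funM => //; exact: emeasurable_funM.
  - by move=> s _; rewrite mule_ge0// lee_fin.
  - by move=> s _; rewrite !mule_ge0// lee_fin.
  - exists (~` G k); split; [exact: measurableC|exact: muG|].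
    move=> s /= hs Gs; apply: hs => _.
    by rewrite indicE mem_set// mul1e.
rewrite ih ?(ltnW kK)//; last 2 first.
- by apply: emeasurable_funM => //; exact: emeasurable_funM.
- by move=> s; rewrite !mule_ge0// lee_fin.
rewrite nu_step; last 2 first.
- by apply: emeasurable_funM => //; exact/measurable_EFinP.
- by move=> s; rewrite mule_ge0// lee_fin.
apply: eq_integral => s _.
have mhs : measurable_fun setT (fun e => h (phi k (s, e))).
  exact: measurableT_comp mhphi (measurable_pair1 s).
have mws a : measurable_fun setT (fun e => (weight k a s e)%:E).
  apply/measurable_EFinP.
  exact: (measurableT_comp (measurable_weight k a) (measurable_pair1 s)).
transitivity (\int[gam]_e ((L k s * \1_(G k) s * w)%:E *
    \sum_a (h (phi k (s, e)) * (weight k a s e)%:E)))%E; last first.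
  apply: eq_integral => e _; rewrite -ge0_sume_distrr; last by move=> a _; rewrite lee_fin.
  rewrite sumEFin muleCA -EFinM Lstep//; congr (_ * EFin _)%E.
  by rewrite -/(weight _ _ _ _) !mulrA.
rewrite ge0_integralZl_EFin; last 4 first.
- by [].
- by move=> e _; apply: sume_ge0 => a _; rewrite mule_ge0// lee_fin.
- by apply: emeasurable_sum => a; exact: emeasurable_funM.
- by rewrite !mulr_ge0.
rewrite ge0_integral_sum//; last 2 first.
- by move=> a; exact: emeasurable_funM.
- by move=> a e _; rewrite mule_ge0// lee_fin.
by rewrite !EFinM muleC !muleA.
Qed.

Lemma likelihood_ratio_second_moment k : (k <= K)%N ->
  (\int[nu k]_s (L k s ^+ 2)%:E <= (expR (r * k%:R))%:E)%E.
Proof.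
elim: k => [_|k ih kK].
  rewrite (eq_integral (cst 1%E)); last by move=> s _; rewrite Lstart expr1n.
  by rewrite integral_cst//= probability_setT mul1e mulr0 expR0.
have mL2 j : measurable_fun setT (fun s => (L j s ^+ 2)%:E).
  by apply/measurable_EFinP; exact: measurable_funX.
rewrite nu_step//; last by move=> s; rewrite lee_fin sqr_ge0.
apply: (@le_trans _ _ (\int[nu k]_s ((expR r)%:E * (L k s ^+ 2)%:E))%E); last first.
  rewrite ge0_integralZl_EFin ?expR_ge0//; last by move=> s _; rewrite lee_fin sqr_ge0.
  rewrite -natr1 mulrDr mulr1 addrC expRD EFinM.
  by rewrite lee_pmul2l// ?lte_fin ?expR_gt0// ih// ltnW.
apply: ge0_le_integral => //.
- by move=> s _; apply: integral_ge0 => e _; rewrite lee_fin sqr_ge0.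
- apply: (@measurable_fun_fubini_tonelli_F _ _ _ _ _ gam
    (fun z => (L k.+1 (phi k z) ^+ 2)%:E)).
    exact: measurableT_comp (mL2 k.+1) (mphi k).
  by move=> z; rewrite lee_fin sqr_ge0.
- by apply: emeasurable_funM => //.
move=> s _.
have mws a : measurable_fun setT (weight k a s).
  exact: (measurableT_comp (measurable_weight k a) (measurable_pair1 s)).
have E e : (L k.+1 (phi k (s, e)) ^+ 2)%:E = ((L k s ^+ 2 * \1_(G k) s)%:E *
    \sum_a \sum_b ((w * w)%:E * ((weight k a s e)%:E * (weight k b s e)%:E)))%E.
  rewrite Lstep// !exprMn.
  have -> : (\1_(G k) s : R) ^+ 2 = \1_(G k) s.
    by rewrite indicE; case: (_ \in _); rewrite ?expr1n ?expr0n.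
  rewrite mulrA EFinM; congr (_ * _)%E.
  rewrite -exprMn mulr_sumr expr2 mulr_suml -sumEFin; apply: eq_bigr => a _.
  rewrite mulr_sumr -sumEFin; apply: eq_bigr => b _.
  by rewrite -!EFinM; congr EFin; rewrite /weight; ring.
under eq_integral do rewrite E.
rewrite ge0_integralZl_EFin; last 4 first.
- by [].
- move=> e _; apply: sume_ge0 => a _; apply: sume_ge0 => b _.
  by rewrite -!EFinM lee_fin !mulr_ge0.
- apply: emeasurable_sum => a; apply: emeasurable_sum => b.
  by do 2 (apply: emeasurable_funM => //); exact/measurable_EFinP.
- by rewrite mulr_ge0// sqr_ge0.
(* Off [G k] the indicator annihilates the new factor, so [moment] is only called where it holds. *)
rewrite indicE; have [/set_mem Gs|_] := boolP (s \in G k); last first.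
  by rewrite mulr0 mul0e -EFinM lee_fin mulr_ge0 ?sqr_ge0 ?expR_ge0.
rewrite mulr1 muleC; apply: lee_wpmul2r; first by rewrite lee_fin sqr_ge0.
apply: le_trans (_ : (\sum_a \sum_b w * w * expR (mxdot (u k a s) (u k b s)))%:E <= _)%E;
  last by rewrite lee_fin moment.
rewrite ge0_integral_sum//; last 2 first.
- move=> a; apply: emeasurable_sum => b.
  by do 2 (apply: emeasurable_funM => //); exact/measurable_EFinP.
- by move=> a e _; apply: sume_ge0 => b _; rewrite -!EFinM lee_fin !mulr_ge0.
rewrite -sumEFin; apply: lee_sum => a _.
rewrite ge0_integral_sum//; last 2 first.
- by move=> b; do 2 (apply: emeasurable_funM => //); exact/measurable_EFinP.
- by move=> b e _; rewrite -!EFinM lee_fin !mulr_ge0.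
rewrite -sumEFin; apply: lee_sum => b _.
rewrite ge0_integralZl_EFin; last 4 first.
- by [].
- by move=> e _; rewrite -EFinM lee_fin mulr_ge0.
- by apply: emeasurable_funM; exact/measurable_EFinP.
- by rewrite mulr_ge0.
rewrite [leRHS]EFinM lee_wpmul2l// ?lee_fin ?mulr_ge0//.
(* The product of the weights of [u_a] and [u_b] is [exp <u_a, u_b>] times the Cameron-Martin
   density of [u_a + u_b], which integrates to one. *)
pose v := u k a s + u k b s.
have mv : measurable_fun setT (fun e => (expR (mxdot v e - mxdot v v / 2))%:E).
  apply/measurable_EFinP; apply: measurableT_comp => //.
  by apply: measurable_funB => //; apply: measurable_mxdot.
rewrite (eq_integral (fun e => (expR (mxdot (u k a s) (u k b s)))%:E *
    (expR (mxdot v e - mxdot v v / 2))%:E))%E.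
  rewrite ge0_integralZl_EFin ?expR_ge0//.
  by rewrite (gaussian_mx_expR _ gam_gaussian) mule1.
move=> e _; rewrite -!EFinM -!expRD; congr (EFin (expR _)).
by rewrite mxdot_sqrD mxdotDl; field.
Qed.

End likelihood_ratio.

(** * Independence of the sources of randomness *)

Definition rV_box {R : realType} {d : nat} (Y : 'I_d -> set R) : set 'rV[R]_d :=
  [set v | forall j, Y j (v ord0 j)].

Lemma measurable_rV_box (R : realType) d (Y : 'I_d -> set R) :
  (forall j, measurable (Y j)) -> measurable (rV_box Y).
Proof.
move=> mY; have := @measurable_mxbox R 1 d (fun=> Y) (fun=> mY).
congr measurable; apply/seteqP; split => v /= h; first by move=> j; exact: h.
by move=> i j; rewrite ord1.
Qed.

Section source_systems.
Context {R : realType} {n d B : nat} {dT : measure_display} {T : measurableType dT}.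
Context {P : probability T R}.
Variables (x noise : process n d P) (I : nat -> 'I_n -> 'I_B -> T -> 'I_n).
Hypothesis noise_gaussian : forall k i, standard_gaussian (noise k i).
Hypothesis I_uniform : forall k i b, uniform_ord P (I k i b).
Hypothesis independent_sources : independent_systems P (rbm_sources I x noise).

Local Notation source := (unit + nat * 'I_n + nat * 'I_n * 'I_B)%type.

Definition noise_mx k (w : T) : 'M[R]_(n, d) := \matrix_(i, j) noise k i w ord0 j.

Lemma measurable_noise_mx k : measurable_fun setT (noise_mx k).
Proof.
apply/measurable_fun_mxP => i j.
apply: (eq_measurable_fun (fun w => noise k i w ord0 j : R)) => [w _|]; first by rewrite mxE.
exact: measurableT_comp (measurable_mx_coord _ _) (measurable_funPT _).
Qed.

HB.instance Definition _ k := isMeasurableFun.Build _ _ _ _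
  (noise_mx k) (measurable_noise_mx k).

Definition batch k (w : T) : {ffun 'I_n -> {ffun 'I_B -> 'I_n}} :=
  [ffun i => [ffun b => I k i b w]].

Definition used_from k (j : source) : bool :=
  match j with
  | inl (inl _) => false
  | inl (inr (l, _)) => (k <= l)%N
  | inr (l, _, _) => (k <= l)%N
  end.

(** Finite intersections suffice: they include the sure event and absorb the noise and batch events
    of step [k], and independence of the sources is itself stated for finite families. *)
Definition future k (C : set T) : Prop :=
  exists (s : seq source) (A : source -> set T),
  [/\ uniq s, all (used_from k) s, forall j, j \in s -> rbm_sources I x noise j (A j)
    & C = \bigcap_(j in [set` s]) A j].

Lemma measurable_source j (A : set T) : rbm_sources I x noise j A -> measurable A.
Proof.
case: j => [[u|[k i]]|[[k i] b]] /=.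
- by move=> [Y mY <-]; exact: measurable_config.
- by move=> [Y mY <-]; exact: measurable_funPT.
- by have [sub _] := I_uniform k i b; exact: sub.
Qed.

Lemma future_setT k : future k setT.
Proof. by exists [::], (fun=> setT); split => //; rewrite set_nil bigcap_set0. Qed.

Lemma measurable_future k C : future k C -> measurable C.
Proof.
move=> [s [A [us _ sA ->]]].
apply: fin_bigcap_measurable => // j /= js; exact: (measurable_source (sA _ js)).
Qed.

Lemma rV_box_prob k i (Y : 'I_d -> set R) : (forall j, measurable (Y j)) ->
  P (noise k i @^-1` rV_box Y) =
  (\prod_j normal_prob 0 1 (Y j))%E.
Proof.
move=> mY; have [ind law] := noise_gaussian k i.
under eq_bigr => j _ do rewrite -(law j _ (mY j)).
rewrite /pushforward -(ind _ (fun j => (fun w => noise k i w ord0 j) @^-1` Y j)).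
- congr (P _); apply/seteqP; split => w /=; first by move=> h j _; exact: h.
  by move=> h j; apply: h; exact: mem_index_enum.
- exact: index_enum_uniq.
- by move=> j _; exists (Y j); [exact: mY|rewrite setTI].
Qed.

Lemma independent_start (dS : measure_display) (S' : measurableType dS)
    (U0 : T -> S') (iota : n.-tuple 'rV[R]_d -> S') X C :
  measurable_fun setT iota -> (forall w, U0 w = iota (config x 0 w)) ->
  measurable X -> future 0 C ->
  P (U0 @^-1` X `&` C) = (P (U0 @^-1` X) * P C)%E.
Proof.
move=> miota U0E mX [s [A [us s0 sA ->]]].
pose j0 : source := inl (inl tt).
have j0s : j0 \notin s by apply/negP => /(allP s0).
pose A' j := if j == j0 then U0 @^-1` X else A j.
have A'E j : j \in s -> A' j = A j.
  by move=> js; rewrite /A'; case: eqP => // jj0; rewrite -jj0 js in j0s.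
rewrite (independent_sources us sA).
have -> : U0 @^-1` X `&` \bigcap_(j in [set` s]) A j = \bigcap_(j in [set` j0 :: s]) A' j.
  apply/seteqP; split => w /=.
    move=> [Uw Aw] j /=; rewrite inE => /orP[/eqP ->|js]; first by rewrite /A' eqxx.
    by rewrite A'E//; exact: Aw.
  move=> h; split; first by have := h j0; rewrite /= inE eqxx /A' eqxx; exact.
  by move=> j /= js; rewrite -A'E//; apply: h; rewrite /= inE js orbT.
rewrite independent_sources/= ?j0s//.
  rewrite big_cons {1}/A' eqxx; congr (_ * _)%E; apply: eq_big_seq => j js.
  by rewrite A'E.
move=> j; rewrite inE => /orP[/eqP ->|js].
  rewrite /A' eqxx /=; exists (iota @^-1` X); first by rewrite -[_ @^-1` _]setTI; exact: miota.
  by rewrite setTI; apply/seteqP; split => w /=; rewrite U0E.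
by rewrite A'E//; exact: sA.
Qed.

(** The sources of step [k] are distinct from those of [C], which start at [k + 1], so independence
    applies to the concatenated family. The weight is the probability of prescribing all [n * B]
    draws. *)
Lemma future_step (gam : probability 'M[R]_(n, d) R) k C a Y :
  gaussian_mx gam -> (forall i j, measurable (Y i j)) -> future k.+1 C ->
  let D := noise_mx k @^-1` mxbox Y `&` (batch k @^-1` [set a] `&` C) in
  future k D /\ P D = (gam (mxbox Y) * ((n%:R^-1 ^+ (n * B))%:E * P C))%E.
Proof.
move=> gg mY [s [A [us sk sA CE]]] D.
pose sN : seq source := [seq inl (inr (k, i)) | i : 'I_n].
pose sI : seq source := [seq inr (k, p.1, p.2) | p : 'I_n * 'I_B].
pose A' (j : source) := match j with
  | inl (inr (l, i)) =>
    if l == k then noise k i @^-1` rV_box (Y i) else A j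
  | inr (l, i, b) => if l == k then I k i b @^-1` [set a i b] else A j
  | _ => A j
  end.
have memN i : inl (inr (k, i)) \in sN by apply/mapP; exists i; rewrite ?mem_enum.
have memI i b : inr (k, i, b) \in sI by apply/mapP; exists (i, b); rewrite ?mem_enum.
have A's j : j \in s -> A' j = A j.
  move=> /(allP sk); rewrite /A'.
  by case: j => [[u|[l i]]|[[l i] b]] //=; case: eqP => // ->; rewrite ltnn.
have uS : uniq (sN ++ sI ++ s).
  rewrite !cat_uniq us andbT; apply/and4P; split.
  - by rewrite map_inj_uniq ?enum_uniq// => i j [].
  - apply/hasPn => j; rewrite mem_cat => /orP[/mapP[p _ ->]|/(allP sk) js].
      by apply/negP => /mapP[].
    by apply/negP => /mapP[i _ jE]; move: js; rewrite jE/= ltnn.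
  - by rewrite map_inj_uniq ?enum_uniq// => -[i b] [j c] [/= -> ->].
  - by apply/hasPn => j /(allP sk) js; apply/negP => /mapP[p _ jE]; move: js; rewrite jE/= ltnn.
have sA' j : j \in sN ++ sI ++ s -> rbm_sources I x noise j (A' j).
  rewrite !mem_cat => /or3P[/mapP[i _ ->]|/mapP[[i b] _ ->]|js].
  - rewrite /= eqxx; exists (rV_box (Y i)); last by rewrite setTI.
    exact: measurable_rV_box.
  - by rewrite /= eqxx; exists [set a i b] => //; rewrite setTI.
  - by rewrite A's//; exact: sA.
have DE : D = \bigcap_(j in [set` sN ++ sI ++ s]) A' j.
  rewrite /D CE; apply/seteqP; split => w /=.
    move=> [Yw [aw Aw]] j /=; rewrite !mem_cat => /or3P[/mapP[i _ ->]|/mapP[[i b] _ ->]|js].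
    - by rewrite /= eqxx => l /=; have := Yw i l; rewrite mxE.
    - by rewrite /= eqxx /= -aw !ffunE.
    - by rewrite A's//; exact: Aw.
  move=> h; split; [|split].
  - move=> i l; have := h (inl (inr (k, i))).
    by rewrite /= !mem_cat memN eqxx => /(_ isT l); rewrite mxE.
  - apply/ffunP => i; apply/ffunP => b; rewrite !ffunE.
    by have := h (inr (k, i, b)); rewrite /= !mem_cat memI orbT eqxx; exact.
  - by move=> j /= js; rewrite -A's//; apply: h; rewrite /= !mem_cat js !orbT.
split.
  exists (sN ++ sI ++ s), A'; split => //.
  rewrite !all_cat; apply/and3P; split.
  - by apply/allP => j /mapP[i _ ->] /=.
  - by apply/allP => j /mapP[p _ ->] /=.
  - apply/allP => j /(allP sk).
    by case: j => [[u|[l i]]|[[l i] b]] //=; exact: ltnW.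
rewrite DE independent_sources// !big_cat/= CE (independent_sources us sA).
congr (_ * (_ * _))%E.
- rewrite gg// big_map big_enum/=; apply: eq_bigr => i _.
  by rewrite eqxx rV_box_prob.
- rewrite big_map big_enum/= (eq_bigr (fun=> (n%:R^-1)%:E)); last first.
    by move=> [i b] _ /=; rewrite eqxx; have [_ ->] := I_uniform k i b.
  by rewrite prodEFin prodr_const card_prod !card_ord.
- by apply: eq_big_seq => j js; rewrite A's.
Qed.

(** Kept general in the state space and in [B], so that both dynamics are instances; the interacting
    one has [B = 0]. *)
Lemma source_process_step (gam : probability 'M[R]_(n, d) R) dS (S : measurableType dS)
    (U : nat -> {mfun T >-> S}) (iota : n.-tuple 'rV[R]_d -> S)
    (psi : nat -> {ffun 'I_n -> {ffun 'I_B -> 'I_n}} -> S * 'M[R]_(n, d) -> S) :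
  gaussian_mx gam -> measurable_fun setT iota ->
  (forall k a, measurable_fun setT (psi k a)) ->
  (forall w, U 0%N w = iota (config x 0 w)) ->
  (forall k w, U k.+1 w = psi k (batch k w) (U k w, noise_mx k w)) ->
  forall k (h : S -> \bar R), measurable_fun setT h -> (forall s, 0 <= h s)%E ->
  (\int[distribution P (U k.+1)]_s h s = (n%:R^-1 ^+ (n * B))%:E *
   \sum_a \int[distribution P (U k)]_s \int[gam]_e h (psi k a (s, e)))%E.
Proof.
move=> gg miota mpsi U0 US k h mh h0.
apply: (driven_process_step (E := noise_mx) (J := batch) (future := future)) => //.
- exact: future_setT.
- exact: measurable_future.
- by move=> l C a Y mY; exact: future_step.
- by move=> X C mX; apply: (@independent_start _ _ (U 0%N) iota).
Qed.

Lemma noise_mx_gaussian k : gaussian_mx (distribution P (noise_mx k)).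
Proof.
move=> Y mY; rewrite /distribution /pushforward.
under eq_bigr => i _ do rewrite -(rV_box_prob k i (mY i)).
pose s : seq source := [seq inl (inr (k, i)) | i : 'I_n].
pose A (j : source) := if j is inl (inr (_, i)) then
  noise k i @^-1` rV_box (Y i) else setT.
transitivity (P (\bigcap_(j in [set` s]) A j)).
  congr (P _); apply/seteqP; split => w /=.
    by move=> h j /= /mapP[i _ ->] l /=; have := h i l; rewrite mxE.
  move=> h i l; rewrite mxE; have := h (inl (inr (k, i))); apply.
  by apply/mapP; exists i; rewrite ?mem_enum.
rewrite independent_sources; first by rewrite big_map big_enum.
  by rewrite map_inj_uniq ?enum_uniq// => i j [].
move=> j /mapP[i _ ->]; exists (rV_box (Y i)); last by rewrite setTI.
exact: measurable_rV_box.
Qed.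

End source_systems.

(** * Particle systems *)

Section matrix_measurability.
Context {R : realType} {d' : measure_display} {T : measurableType d'} {m d : nat}.
Implicit Types f g : T -> 'M[R]_(m, d).

Lemma measurable_fun_mxD f g : measurable_fun setT f -> measurable_fun setT g ->
  measurable_fun setT (fun x => f x + g x).
Proof.
move=> /measurable_fun_mxP mf /measurable_fun_mxP mg; apply/measurable_fun_mxP => i j.
apply: (eq_measurable_fun (fun x => f x i j + g x i j)) => [x _|]; first by rewrite mxE.
exact: measurable_funD.
Qed.

Lemma measurable_fun_mxZ (c : R) f : measurable_fun setT f ->
  measurable_fun setT (fun x => c *: f x).
Proof.
move=> /measurable_fun_mxP mf; apply/measurable_fun_mxP => i j.
apply: (eq_measurable_fun (fun x => c * f x i j)) => [x _|]; first by rewrite mxE.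
exact: measurable_funM.
Qed.

Lemma measurable_fun_mx_sum I (s : seq I) (f : I -> T -> 'M[R]_(m, d)) :
  (forall i, measurable_fun setT (f i)) -> measurable_fun setT (fun x => \sum_(i <- s) f i x).
Proof.
move=> mf; apply/measurable_fun_mxP => i j.
apply: (eq_measurable_fun (fun x => \sum_(k <- s) f k x i j)) => [x _|].
  by rewrite summxE.
by apply: measurable_sum => k; move: i j; apply/measurable_fun_mxP.
Qed.

Lemma measurable_fun_row i f : measurable_fun setT f ->
  measurable_fun setT (fun x => row i (f x)).
Proof.
move=> /measurable_fun_mxP mf; apply/measurable_fun_mxP => k j.
by apply: (eq_measurable_fun (fun x => f x i j)) => // x _; rewrite mxE.
Qed.

End matrix_measurability.

(** * Padded paths and Euler steps *)

Section paths.
Context {R : realType} {n d K : nat}.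
Local Notation conf := (n.-tuple 'rV[R]_d).
Local Notation path := (K.+1.-tuple conf).

Definition path_at k (s : path) : conf := tnth s (inord k).

Lemma measurable_path_at k : measurable_fun setT (path_at k).
Proof. exact: measurable_tnth. Qed.

(** Step [k] writes entry [k + 1]; for [k >= K] no such entry exists and the path is unchanged. *)
Definition path_update k (s : path) (y : conf) : path :=
  [tuple if (j == k.+1 :> nat) then y else tnth s j | j < K.+1].

Lemma path_at_update_lt k l s y : (k < K)%N -> (l <= k)%N ->
  path_at l (path_update k s y) = path_at l s.
Proof.
move=> kK lk; rewrite /path_at tnth_mktuple inordK; last first.
  by rewrite ltnS (leq_trans lk) 1?ltnW.
by rewrite ltn_eqF// ltnS.
Qed.

Lemma path_at_update_eq k s y : (k < K)%N -> path_at k.+1 (path_update k s y) = y.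
Proof. by move=> kK; rewrite /path_at tnth_mktuple inordK// eqxx. Qed.

Lemma measurable_path_update d' (T : measurableType d') k (f : T -> path) (h : T -> conf) :
  measurable_fun setT f -> measurable_fun setT h ->
  measurable_fun setT (fun x => path_update k (f x) (h x)).
Proof.
move=> mf mh; apply/measurable_fun_tnthP => j.
apply: (eq_measurable_fun (fun x => if (j == k.+1 :> nat) then h x else tnth (f x) j)).
  by move=> x _; rewrite /= tnth_mktuple.
case: (j == k.+1 :> nat) => //; exact: measurableT_comp (measurable_tnth _) mf.
Qed.

Definition start_path (y : conf) : path :=
  [tuple if (j == 0%N :> nat) then y else [tuple 0 | _ < n] | j < K.+1].

Lemma measurable_start_path : measurable_fun setT start_path.
Proof.
apply/measurable_fun_tnthP => j.
apply: (eq_measurable_fun (fun y : conf => if (j == 0%N :> nat) then y else [tuple 0 | _ < n])).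
  by move=> x _; rewrite /= tnth_mktuple.
by case: (j == 0%N :> nat).
Qed.

Definition later_positions (s : path) : K.-tuple conf := [tuple path_at k.+1 s | k < K].

Lemma measurable_later_positions : measurable_fun setT later_positions.
Proof.
apply/measurable_fun_tnthP => j.
apply: (eq_measurable_fun (path_at j.+1)); last exact: measurable_path_at.
by move=> s _; rewrite /= tnth_mktuple.
Qed.

Section truncation.
Context {dT : measure_display} {T : measurableType dT} {P : probability T R}.
Variable x : process n d P.

(* Padding with zeros makes the state space independent of [k]. *)
Definition truncated_path k (w : T) : path :=
  [tuple if (j <= k)%N then config x j w else [tuple 0 | _ < n] | j < K.+1].

Lemma measurable_truncated_path k : measurable_fun setT (truncated_path k).
Proof.
apply/measurable_fun_tnthP => j.
apply: (eq_measurable_fun (fun w => if (j <= k)%N then config x j w else [tuple 0 | _ < n])).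
  by move=> w _; rewrite /= tnth_mktuple.
by case: (j <= k)%N => //; exact: measurable_config.
Qed.

HB.instance Definition _ k := isMeasurableFun.Build _ _ _ _
  (truncated_path k) (@measurable_truncated_path k).

Lemma truncated_path0 w : truncated_path 0 w = start_path (config x 0 w).
Proof.
by apply: eq_from_tnth => j; rewrite !tnth_mktuple leqn0; case: eqP => // ->.
Qed.

Lemma truncated_pathS k w :
  truncated_path k.+1 w = path_update k (truncated_path k w) (config x k.+1 w).
Proof.
apply: eq_from_tnth => j; rewrite !tnth_mktuple leq_eqVlt ltnS.
by case: eqP => [->|].
Qed.

Lemma path_at_truncated k w : (k <= K)%N -> path_at k (truncated_path k w) = config x k w.
Proof. by move=> kK; rewrite /path_at tnth_mktuple inordK// leqnn. Qed.

Lemma later_positions_truncated w : later_positions (truncated_path K w) = trajectory x K w.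
Proof.
apply: eq_from_tnth => k; rewrite !tnth_mktuple /path_at tnth_mktuple inordK ?ltnS//.
by rewrite ltn_ord.
Qed.

End truncation.

Definition euler_step (c : R) (b : conf -> 'I_n -> 'rV[R]_d) k (z : path * 'M[R]_(n, d)) : path :=
  path_update k z.1 [tuple b (path_at k z.1) i + c *: row i z.2 | i < n].

Lemma measurable_euler_step c b k : (forall i, measurable_fun setT (b^~ i)) ->
  measurable_fun setT (euler_step c b k).
Proof.
move=> mb; apply: measurable_path_update => //.
apply/measurable_fun_tnthP => i.
apply: (eq_measurable_fun (fun z : path * 'M[R]_(n, d) => b (path_at k z.1) i + c *: row i z.2)).
  by move=> z _; rewrite /= tnth_mktuple.
apply: measurable_fun_mxD; last exact/measurable_fun_mxZ/measurable_fun_row.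
apply: (measurableT_comp (mb i)).
exact: measurableT_comp (measurable_path_at k) measurable_fst.
Qed.

End paths.
Arguments truncated_path {R n d} K {dT T P} x k w.

(** * Drifts of the two dynamics and the noise shift between them *)

Section particle_drifts.
Context {R : realType} {n d B : nat}.
Variables (eta sigma M : R).
Variables (g : nat -> 'I_n -> 'rV[R]_d -> 'rV[R]_d).
Variables (F : nat -> 'I_n -> 'I_n -> 'rV[R]_d -> 'rV[R]_d -> 'rV[R]_d).
Hypothesis eta0 : 0 < eta.
Hypothesis sigma0 : 0 < sigma.
Hypothesis n0 : (0 < n)%N.
Hypothesis B0 : (0 < B)%N.
Hypothesis mg : forall k i, measurable_fun setT (g k i).
Hypothesis mF : forall k i j, measurable_fun setT
  (fun z : 'rV[R]_d * 'rV[R]_d => F k i j z.1 z.2).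
Hypothesis small_step : eta * (40 * M ^+ 2) <= B%:R * sigma ^+ 2.

Local Notation conf := (n.-tuple 'rV[R]_d).
Local Notation choices := {ffun 'I_n -> {ffun 'I_B -> 'I_n}}.
Local Notation c := (Num.sqrt eta * sigma).

Let c0 : 0 < c. Proof. by rewrite mulr_gt0// sqrtr_gt0. Qed.
Let n0R : 0 < n%:R :> R. Proof. by rewrite ltr0n. Qed.
Let B0R : 0 < B%:R :> R. Proof. by rewrite ltr0n. Qed.

Definition force k i j (z : conf) : 'rV[R]_d := F k i j (tnth z i) (tnth z j).

Definition ipd_drift k (z : conf) i : 'rV[R]_d :=
  tnth z i + eta *: g k i (tnth z i) + (eta / n%:R) *: (\sum_j force k i j z).

Definition rbm_drift k (a : choices) (z : conf) i : 'rV[R]_d :=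
  tnth z i + eta *: g k i (tnth z i) + eta *: (B%:R^-1 *: (\sum_b force k i (a i b) z)).

(** The Cameron-Martin shift: the displacement of the noise that makes an interacting step land
    where the batch step does. *)
Definition noise_shift k (a : choices) (z : conf) : 'M[R]_(n, d) :=
  \matrix_(i, j) (c^-1 *: (rbm_drift k a z i - ipd_drift k z i)) ord0 j.

Lemma measurable_force k i j : measurable_fun setT (force k i j).
Proof.
apply: (measurableT_comp (mF k i j) (g := fun z : conf => (tnth z i, tnth z j))).
by apply: measurable_fun_pair; exact: measurable_tnth.
Qed.

Lemma measurable_ipd_drift k i : measurable_fun setT ((ipd_drift k)^~ i).
Proof.
apply: measurable_fun_mxD; last first.
  by apply: measurable_fun_mxZ; apply: measurable_fun_mx_sum => j; exact: measurable_force.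
apply: measurable_fun_mxD; first exact: measurable_tnth.
by apply: measurable_fun_mxZ; exact: measurableT_comp (mg k i) (measurable_tnth i).
Qed.

Lemma measurable_rbm_drift k a i : measurable_fun setT ((rbm_drift k a)^~ i).
Proof.
apply: measurable_fun_mxD; last first.
  do 2 apply: measurable_fun_mxZ.
  by apply: measurable_fun_mx_sum => j; exact: measurable_force.
apply: measurable_fun_mxD; first exact: measurable_tnth.
by apply: measurable_fun_mxZ; exact: measurableT_comp (mg k i) (measurable_tnth i).
Qed.

Lemma measurable_noise_shift k a : measurable_fun setT (noise_shift k a).
Proof.
apply/measurable_fun_mxP => i j.
apply: (eq_measurable_fun (fun z =>
    (c^-1 *: (rbm_drift k a z i + (-1) *: ipd_drift k z i)) ord0 j)).
  by move=> z _; rewrite [RHS]mxE scaleN1r.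
apply: measurableT_comp (measurable_mx_coord _ _) _.
apply: measurable_fun_mxZ; apply: measurable_fun_mxD; first exact: measurable_rbm_drift.
by apply: measurable_fun_mxZ; exact: measurable_ipd_drift.
Qed.

Lemma noise_shift_rowE k a z i :
  row i (noise_shift k a z) = c^-1 *: (rbm_drift k a z i - ipd_drift k z i).
Proof. by apply/rowP => j; rewrite mxE [LHS]mxE. Qed.

Lemma euler_step_shift K k a (s : K.+1.-tuple conf) e :
  euler_step c (rbm_drift k a) k (s, e) =
  euler_step c (ipd_drift k) k (s, e + noise_shift k a (path_at k s)).
Proof.
congr path_update; apply: eq_from_tnth => i; rewrite !tnth_mktuple /=.
rewrite linearD/= noise_shift_rowE scalerDr scalerA mulfV ?gt_eqF// scale1r.
by rewrite [RHS]addrCA [ipd_drift _ _ _ + _]addrC subrK addrC.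
Qed.

Definition bounded_forces k : set conf :=
  [set z | forall i j, mxdot (force k i j z) (force k i j z) <= M ^+ 2].

Lemma measurable_bounded_forces k : measurable (bounded_forces k).
Proof.
have -> : bounded_forces k = \bigcap_(p in [set: 'I_n * 'I_n])
    [set z | mxdot (force k p.1 p.2 z) (force k p.1 p.2 z) <= M ^+ 2].
  by apply/seteqP; split => z /= h; [move=> p _; exact: h|move=> i j; exact: (h (i, j))].
apply: fin_bigcap_measurable => // p _.
rewrite -[X in measurable X]setTI; apply: measurable_fun_le => //.
by apply: measurable_mxdot; exact: measurable_force.
Qed.

Let centered k i j z := force k i j z - n%:R^-1 *: \sum_l force k i l z.

Let noise_shift_row k a z i : row i (noise_shift k a z) =
  (c^-1 * eta / B%:R) *: \sum_b centered k i (a i b) z.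
Proof.
rewrite noise_shift_rowE /rbm_drift /ipd_drift opprD addrACA addrN add0r.
rewrite /centered sumrB sumr_const card_ord.
move: (\sum_b _) (\sum_l _) => X Y.
apply/rowP => j; rewrite !(mxE, mulmxnE) -mulr_natr; field.
by rewrite !gt_eqF// sqrtr_gt0.
Qed.

Let centered_sum k i z : \sum_j centered k i j z = 0.
Proof.
rewrite /centered sumrB sumr_const card_ord -scaler_nat scalerA mulfV ?gt_eqF//.
by rewrite scale1r subrr.
Qed.

(** Parallelogram identity: with [m] the mean force, [|f - m|^2 + |f + m|^2 = 2 |f|^2 + 2 |m|^2].
    The bound on [|m|^2] averages those on the inner products. *)
Let centered_le k i j z : bounded_forces k z ->
  mxdot (centered k i j z) (centered k i j z) <= 4 * M ^+ 2.
Proof.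
move=> bz.
have dot_le l l' : mxdot (force k i l z) (force k i l' z) <= M ^+ 2.
  have := mxdot_sqr_ge0 (force k i l z - force k i l' z).
  rewrite -scaleN1r mxdot_sqrD !(mxdotZl, mxdotZr).
  have := bz i l; have := bz i l'; lra.
pose m := n%:R^-1 *: \sum_l force k i l z.
have mm : mxdot m m <= M ^+ 2.
  rewrite /m mxdotZl mxdotZr mxdot_suml.
  under eq_bigr do rewrite mxdotC mxdot_suml.
  rewrite mulrA -invfM ler_pdivrMl ?mulr_gt0//.
  apply: (@le_trans _ _ (\sum_(i < n) \sum_(i < n) M ^+ 2)).
    by apply: ler_sum => l _; apply: ler_sum => l' _; exact: dot_le.
  by rewrite !sumr_const !card_ord -mulrnA -[leLHS]mulr_natl natrM.
have := mxdot_sqr_ge0 (force k i j z + m).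
rewrite /centered -/m; move: m mm => m mm; rewrite -scaleN1r !mxdot_sqrD !(mxdotZl, mxdotZr).
have := bz i j; lra.
Qed.

(** Row [i] of the shift depends only on the batch of particle [i], so the double sum factors into
    one batch moment per particle. *)
Lemma noise_shift_moment k z : bounded_forces k z ->
  \sum_(a : choices) \sum_(a' : choices) n%:R^-1 ^+ (n * B) * n%:R^-1 ^+ (n * B) *
    expR (mxdot (noise_shift k a z) (noise_shift k a' z))
  <= expR (64 * (eta ^+ 2 * M ^+ 4 * n%:R / (B%:R ^+ 2 * sigma ^+ 4))).
Proof.
move=> bz.
pose s := (c^-1 * eta / B%:R) ^+ 2.
pose f i (b b' : {ffun 'I_B -> 'I_n}) := n%:R^-1 ^+ B * n%:R^-1 ^+ B *
  expR (s * mxdot (\sum_l centered k i (b l) z) (\sum_l centered k i (b' l) z)).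
have sE : s = eta / (B%:R ^+ 2 * sigma ^+ 2).
  have -> : s = eta ^+ 2 / ((Num.sqrt eta) ^+ 2 * sigma ^+ 2 * B%:R ^+ 2).
    by rewrite /s; field; rewrite !gt_eqF// sqrtr_gt0.
  rewrite sqr_sqrtr ?ltW//; field; rewrite !gt_eqF//.
have qsB : 4 * M ^+ 2 * s * B%:R = 4 * M ^+ 2 * eta / (B%:R * sigma ^+ 2).
  by rewrite sE; field; rewrite !gt_eqF//.
(* The 40 in the step-size condition yields [1 / 10], and [64 / 100 <= 1] meets the requirement of
   the batch moment bound. *)
have qsB10 : 0 <= 4 * M ^+ 2 * s * B%:R <= 10^-1.
  have Bs : 0 < B%:R * sigma ^+ 2 by rewrite mulr_gt0// exprn_gt0.
  rewrite qsB divr_ge0 ?(ltW Bs)//=; last first.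
    by rewrite mulr_ge0 ?(ltW eta0)// mulr_ge0// sqr_ge0.
  by rewrite ler_pdivrMr//; move: small_step; lra.
apply: (@le_trans _ _ (\prod_(i < n) \sum_b \sum_b' f i b b')).
  rewrite bigA_distr_bigA/=; apply: ler_sum => a _.
  rewrite bigA_distr_bigA/=; apply: ler_sum => a' _.
  rewrite /f big_split/= big_split/= !prodr_const card_ord -!exprM (mulnC B).
  rewrite mxdot_row -expR_sum; apply: ler_wpM2l.
    by rewrite mulr_ge0// exprn_ge0// invr_ge0 ltW.
  rewrite ler_expR; apply: ler_sum => i _.
  by rewrite !noise_shift_row mxdotZl mxdotZr mulrA -expr2.
apply: (@le_trans _ _ (\prod_(i < n) expR (4 * (4 * M ^+ 2 * s * B%:R) ^+ 2))).
  apply: ler_prod => i _; apply/andP; split.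
    apply: sumr_ge0 => b _; apply: sumr_ge0 => b' _.
    by rewrite !mulr_ge0 ?expR_ge0// exprn_ge0// invr_ge0 ltW.
  apply: (batch_exponential_moment (Y := fun j => centered k i j z) (q := 4 * M ^+ 2)) => //.
  - by move=> j; exact: centered_le.
  - by move: qsB10 => /andP[]; nra.
rewrite prodr_const card_ord -expRM_natl ler_expR qsB.
rewrite le_eqVlt; apply/orP; left; apply/eqP; field.
by rewrite !gt_eqF//.
Qed.

End particle_drifts.

(** * The two particle systems as instances of the abstract scheme *)

Section kl_bound.
Context {R : realType} {n d K B : nat} {eta sigma M : R}.
Variables (g : nat -> 'I_n -> 'rV[R]_d -> 'rV[R]_d).
Variables (F : nat -> 'I_n -> 'I_n -> 'rV[R]_d -> 'rV[R]_d -> 'rV[R]_d).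
Context {d1 : measure_display} {T1 : measurableType d1} {P1 : probability T1 R}.
Context {d2 : measure_display} {T2 : measurableType d2} {P2 : probability T2 R}.
Variables (x noise : process n d P1) (xh noiseh : process n d P2).
Variable I : nat -> 'I_n -> 'I_B -> T2 -> 'I_n.
Hypothesis B_range : (1 <= B <= n)%N.
Hypothesis eta0 : 0 < eta.
Hypothesis sigma0 : 0 < sigma.
Hypothesis mg : forall k i, measurable_fun setT (g k i).
Hypothesis mF : forall k i j, measurable_fun setT
  (fun z : 'rV[R]_d * 'rV[R]_d => F k i j z.1 z.2).
Hypothesis ipd : is_IPD g F eta sigma x noise.
Hypothesis rbm : is_RBM g F eta sigma I xh noiseh.
Hypothesis same_start : forall A : set (n.-tuple 'rV[R]_d), measurable A ->
  distribution P2 (config xh 0) A = distribution P1 (config x 0) A.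
Hypothesis force_bound : forall k i j, (k <= K)%N ->
  \forall w \ae P2, norm2 (F k i j (xh k i w) (xh k j w)) <= M.
Hypothesis small_step : eta * (40 * M ^+ 2) <= B%:R * sigma ^+ 2.

Local Notation conf := (n.-tuple 'rV[R]_d).
Local Notation path := (K.+1.-tuple conf).
Local Notation choices := {ffun 'I_n -> {ffun 'I_B -> 'I_n}}.
Local Notation c := (Num.sqrt eta * sigma).
Local Notation w := (n%:R^-1 ^+ (n * B) : R).
Local Notation rho := (64 * (eta ^+ 2 * M ^+ 4 * n%:R / (B%:R ^+ 2 * sigma ^+ 4))).

Let B0 : (0 < B)%N. Proof. by have /andP[] := B_range. Qed.
Let n0 : (0 < n)%N. Proof. by have /andP[_] := B_range; exact: leq_trans. Qed.
Let c0 : 0 < c. Proof. by rewrite mulr_gt0// sqrtr_gt0. Qed.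
Let w0 : 0 <= w. Proof. by rewrite exprn_ge0// invr_ge0. Qed.

(* The interacting dynamics is a random batch process that draws no batch. *)
Let ipd_no_batch : independent_systems P1
  (rbm_sources (fun _ _ (b : 'I_0) _ => Ordinal n0) x noise).
Proof.
have [_ ind _] := ipd.
move=> s A us sA.
pose s' := pmap (fun j : unit + nat * 'I_n + nat * 'I_n * 'I_0 =>
  if j is inl j' then Some j' else None) s.
have ss' : s = map inl s'.
  rewrite /s'; elim: s {us sA s'} => [//|[j|[[k i] []]] s ih] //=.
  by rewrite -ih.
rewrite ss' big_map -(ind s' (A \o inl)).
- congr (P1 _); apply/seteqP; split => y h j /=.
    by move=> js; apply: h => /=; rewrite map_f.
  by move=> /mapP[j' js ->]; exact: h.
- by rewrite -(map_inj_uniq (f := inl : _ -> _ + nat * 'I_n * 'I_0)) -?ss'// => u v [].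
- by move=> j js; have := sA (inl j); rewrite ss' map_f//; exact.
Qed.

(** The law of the first noise matrix serves as the reference Gaussian law; any step would do, since
    boxes determine it. *)
Let gam : probability 'M[R]_(n, d) R := distribution P1 (noise_mx noise 0).

Let gam_gaussian : gaussian_mx gam.
Proof.
have [gauss _ _] := ipd.
exact: (noise_mx_gaussian gauss ipd_no_batch).
Qed.

Let mu k : probability path R := distribution P2 (truncated_path K xh k).
Let nu k : probability path R := distribution P1 (truncated_path K x k).
Let phi k := @euler_step R n d K c (ipd_drift eta g F k) k.
Let u k (a : choices) (s : path) := noise_shift eta sigma g F k a (path_at k s).
Let G k : set path := path_at k @^-1` bounded_forces M F k.

(** Solving the interacting step for its noise makes the likelihood ratio a function of the path
    alone. *)
Let noise_of k (s : path) : 'M[R]_(n, d) := \matrix_(i, j)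
  (c^-1 *: (tnth (path_at k.+1 s) i - ipd_drift eta g F k (path_at k s) i)) ord0 j.

Let ratio l (s : path) (e : 'M[R]_(n, d)) : R := \1_(G l) s * (w * \sum_a
  expR (mxdot (u l a s) e - mxdot (u l a s) (u l a s) / 2)).

Let L k (s : path) : R := \prod_(l < k) ratio l s (noise_of l s).

Let mphi k : measurable_fun setT (phi k).
Proof. by apply: measurable_euler_step => i; exact: measurable_ipd_drift. Qed.

Let m_u k a : measurable_fun setT (u k a).
Proof.
by apply: measurableT_comp (measurable_path_at k); exact: measurable_noise_shift.
Qed.

Let mG k : measurable (G k).
Proof.
rewrite /G -[_ @^-1` _]setTI; apply: measurable_path_at => //.
exact: measurable_bounded_forces.
Qed.

Let mnoise_of k : measurable_fun setT (noise_of k).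
Proof.
apply/measurable_fun_mxP => i j.
apply: (eq_measurable_fun (fun s : path => (c^-1 *: (tnth (path_at k.+1 s) i +
    (-1) *: ipd_drift eta g F k (path_at k s) i)) ord0 j)).
  by move=> s _; rewrite [RHS]mxE scaleN1r.
apply: measurableT_comp (measurable_mx_coord _ _) _.
apply: measurable_fun_mxZ; apply: measurable_fun_mxD.
  exact: measurableT_comp (measurable_tnth i) (measurable_path_at k.+1).
apply: measurable_fun_mxZ.
exact: measurableT_comp (measurable_ipd_drift eta mg mF k i) (measurable_path_at k).
Qed.

Let mL k : measurable_fun setT (L k).
Proof.
apply: measurable_prod => l _; apply: measurable_funM; first exact: measurable_indic.
apply: measurable_funM => //; apply: measurable_sum => a.
apply: measurableT_comp => //.
by apply: measurable_funB; [|apply: measurable_funM => //]; exact: measurable_mxdot.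
Qed.

Let L0 k s : 0 <= L k s.
Proof.
apply: prodr_ge0 => l _; rewrite mulr_ge0// mulr_ge0//.
by apply: sumr_ge0 => a _; exact: expR_ge0.
Qed.

Let Lstep k s e : (k < K)%N -> L k.+1 (phi k (s, e)) = L k s * (\1_(G k) s *
  (w * \sum_a expR (mxdot (u k a s) e - mxdot (u k a s) (u k a s) / 2))).
Proof.
move=> kK.
have at_lt l : (l <= k)%N -> path_at l (phi k (s, e)) = path_at l s.
  by move=> lk; rewrite /phi /euler_step path_at_update_lt.
have ratio_lt l e' : (l <= k)%N -> ratio l (phi k (s, e)) e' = ratio l s e'.
  move=> lk; rewrite /ratio /u at_lt//; congr (_ * _).
  by rewrite !indicE; congr (nat_of_bool _)%:R; apply/idP/idP; rewrite !inE /G /= at_lt.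
have noise_k : noise_of k (phi k (s, e)) = e.
  have at_eq : path_at k.+1 (phi k (s, e)) =
      [tuple ipd_drift eta g F k (path_at k s) i + c *: row i e | i < n].
    exact: path_at_update_eq.
  apply/matrixP => i j; rewrite mxE (at_lt k)// at_eq tnth_mktuple addrAC subrr add0r.
  by rewrite scalerA mulVf ?gt_eqF// scale1r mxE.
(* Factor [l < k] reads positions up to [l + 1 <= k] only, and step [k] writes position [k + 1]. *)
have L_lt : L k (phi k (s, e)) = L k s.
  apply: eq_bigr => l _.
  have lk : (l < k)%N := ltn_ord l.
  have -> : noise_of l (phi k (s, e)) = noise_of l s.
    by apply/matrixP => i j; rewrite !mxE !at_lt// ltnW.
  by rewrite ratio_lt// ltnW.
have prodS (f : nat -> R) : \prod_(l < k.+1) f l = (\prod_(l < k) f l) * f k.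
  by rewrite big_ord_recr.
transitivity (L k (phi k (s, e)) * ratio k (phi k (s, e)) (noise_of k (phi k (s, e)))).
  exact: (prodS (fun l => ratio l (phi k (s, e)) (noise_of l (phi k (s, e))))).
by rewrite L_lt noise_k ratio_lt.
Qed.

Let start X : measurable X -> mu 0%N X = nu 0%N X.
Proof.
move=> mX; rewrite /mu /nu /distribution /pushforward.
have miX : measurable (@start_path R n d K @^-1` X).
  by rewrite -[_ @^-1` _]setTI; exact: measurable_start_path.
have E (dT : measure_display) (T : measurableType dT) (P : probability T R) (y : process n d P) :
    truncated_path K y 0 @^-1` X = config y 0 @^-1` (@start_path R n d K @^-1` X).
  by apply/seteqP; split => v /=; rewrite truncated_path0.
transitivity (P2 (config xh 0 @^-1` (@start_path R n d K @^-1` X))).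
  by rewrite -E.
by rewrite [LHS](same_start miX) /distribution /pushforward -E.
Qed.

Let nu_step k (h : path -> \bar R) : measurable_fun setT h -> (forall s, 0 <= h s)%E ->
  (\int[nu k.+1]_s h s = \int[nu k]_s \int[gam]_e h (phi k (s, e)))%E.
Proof.
move=> mh h0; have [gauss _ step] := ipd.
have unif (k' : nat) (i : 'I_n) (b : 'I_0) : uniform_ord P1 (fun=> Ordinal n0) by case: b.
rewrite /nu (source_process_step gauss unif ipd_no_batch (gam := gam)
  (iota := @start_path R n d K) (psi := fun k _ => phi k) (U := truncated_path K x))//.
- rewrite muln0 expr0 mul1e (big_pred1 [ffun i => [ffun b : 'I_0 => Ordinal n0]])//.
  by move=> a /=; apply/esym/eqP/ffunP => i; apply/ffunP => -[].
- exact: measurable_start_path.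
- by move=> v; exact: truncated_path0.
move=> l v.
transitivity (path_update l (truncated_path K x l v) (config x l.+1 v)).
  exact: truncated_pathS.
rewrite /phi /euler_step /=.
(* Past the horizon both updates leave the path unchanged, so the recursion holds for every [l], as
   the transition lemma requires. *)
have [lK|Kl] := leqP l K; last first.
  apply: eq_from_tnth => j; rewrite !tnth_mktuple ltn_eqF// ltnS.
  by rewrite (leq_trans _ (ltnW Kl))// -ltnS.
congr path_update; apply: eq_from_tnth => i; rewrite !tnth_mktuple.
rewrite path_at_truncated// step /ipd_drift /force !tnth_mktuple; congr (_ + _ *: _ + _ *: _).
  by apply: eq_bigr => j _; rewrite tnth_mktuple.
by apply/rowP => j; rewrite !mxE.
Qed.

Let mu_step k (h : path -> \bar R) : measurable_fun setT h -> (forall s, 0 <= h s)%E ->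
  (\int[mu k.+1]_s h s =
   w%:E * \sum_a \int[mu k]_s \int[gam]_e h (phi k (s, e + u k a s)%R))%E.
Proof.
move=> mh h0; have [gauss unif ind step] := rbm.
have mpsi l (a : choices) : measurable_fun setT (@euler_step R n d K c (rbm_drift eta g F l a) l).
  by apply: measurable_euler_step => i; exact: measurable_rbm_drift.
have US l v : truncated_path K xh l.+1 v =
    @euler_step R n d K c (rbm_drift eta g F l (batch I l v)) l
      (truncated_path K xh l v, noise_mx noiseh l v).
  rewrite truncated_pathS /euler_step /=.
  have [lK|Kl] := leqP l K; last first.
    apply: eq_from_tnth => j; rewrite !tnth_mktuple ltn_eqF// ltnS.
    by rewrite (leq_trans _ (ltnW Kl))// -ltnS.
  congr path_update; apply: eq_from_tnth => i; rewrite !tnth_mktuple.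
  rewrite path_at_truncated// step /rbm_drift /force !tnth_mktuple /batch_force.
  congr (_ + _ *: (_ *: _) + _ *: _).
    by apply: eq_bigr => b _; rewrite !ffunE !tnth_mktuple.
  by apply/rowP => j; rewrite !mxE.
have E := source_process_step gauss unif ind (U := truncated_path K xh)
  (psi := fun l a => @euler_step R n d K c (rbm_drift eta g F l a) l) gam_gaussian
  (@measurable_start_path R n d K) mpsi (fun v => truncated_path0 xh v) US k mh h0.
apply: etrans E _; apply: (f_equal (mule w%:E)).
apply: eq_bigr => a _; apply: eq_integral => s _; apply: eq_integral => e _.
by rewrite (euler_step_shift g F eta0 sigma0).
Qed.

Let muG k : (k < K)%N -> mu k (~` G k) = 0%E.
Proof.
move=> kK.
have : \forall v \ae P2, forall p : 'I_n * 'I_n,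
    norm2 (F k p.1 p.2 (xh k p.1 v) (xh k p.2 v)) <= M.
  by apply: filter_forall => p; exact: force_bound (ltnW kK).
move=> [N [mN N0 sub]].
suff : P2 (truncated_path K xh k @^-1` (~` G k)) = 0%E by [].
apply: (subset_measure0 _ mN _ N0).
  rewrite -[X in measurable X]setTI; apply: measurable_funPT => //; exact: measurableC.
move=> v nG; apply: sub => H.
have at_k : path_at k (truncated_path K xh k v) = config xh k v.
  by rewrite path_at_truncated// ltnW.
have bv : bounded_forces M F k (config xh k v).
  move=> i j; rewrite /force !tnth_mktuple -norm2_sqr.
  (* Squaring requires [0 <= M], which the bound itself supplies because [M] dominates a norm. *)
  have Hij := H (i, j).
  by rewrite lerXn2r ?nnegrE ?sqrtr_ge0// (le_trans (sqrtr_ge0 _) Hij).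
by rewrite -at_k in bv; exact: nG bv.
Qed.

Lemma KL_trajectory_le :
  (KL (distribution P2 (trajectory xh K)) (distribution P1 (trajectory x K))
   <= (rho * K%:R)%:E)%E.
Proof.
apply: KL_le => h mh h0.
(* A test function of the later positions is one of the whole path, so the dual bound is inherited
   by the law without initial positions. *)
pose h' (s : path) := h (later_positions s).
have mh' : measurable_fun setT h' by exact: measurableT_comp mh measurable_later_positions.
have transfer (dT : measure_display) (T : measurableType dT) (P : probability T R)
    (y : process n d P) (f : K.-tuple conf -> R) : measurable_fun setT f -> (forall z, 0 <= f z) ->
    (\int[distribution P (trajectory y K)]_z (f z)%:E =
     \int[distribution P (truncated_path K y K)]_s (f (later_positions s))%:E)%E.
  move=> mf f0; rewrite ge0_integral_distribution;
    [|exact/measurable_EFinP|by move=> s; rewrite lee_fin].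
  rewrite ge0_integral_distribution; last 2 first.
  - by apply/measurable_EFinP; exact: measurableT_comp mf measurable_later_positions.
  - by move=> s; rewrite lee_fin.
  by apply: eq_integral => v _; rewrite /= later_positions_truncated.
rewrite (transfer _ _ _ xh _ mh h0).
rewrite (transfer _ _ _ x _ (measurable_funX 2 mh) (fun z => sqr_ge0 (h z))).
have h'0 s : 0 <= h' s by exact: h0.
have mh'E : measurable_fun setT (EFin \o h') by exact/measurable_EFinP.
have mLE : measurable_fun setT (EFin \o L K) by exact/measurable_EFinP.
have Lstart s : L 0%N s = 1 by rewrite /L big_ord0.
have moment k s : G k s -> \sum_a \sum_b w * w * expR (mxdot (u k a s) (u k b s)) <= expR rho.
  by move=> Gs; exact: (noise_shift_moment g eta0 sigma0 n0 B0 small_step).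
have -> : (\int[distribution P2 (truncated_path K xh K)]_s (h (later_positions s))%:E =
    \int[nu K]_s ((h' s)%:E * (L K s)%:E))%E.
  apply: (likelihood_ratio_density gam_gaussian w0 mphi m_u mG mL L0 Lstart Lstep
    start nu_step mu_step muG) => //.
have m2 := likelihood_ratio_second_moment gam_gaussian w0 mphi m_u mL Lstart Lstep
  nu_step moment (leqnn K).
have mh2 : measurable_fun setT (fun s => (h' s ^+ 2)%:E).
  by apply/measurable_EFinP; exact: measurable_funX.
have mL2 : measurable_fun setT (fun s => (L K s ^+ 2)%:E).
  by apply/measurable_EFinP; exact: measurable_funX.
(* The dual bound comes from [2 h' L <= L^2 + h'^2] pointwise and the second moment of [L]. *)
apply: (@le_trans _ _ (\int[nu K]_s ((L K s ^+ 2)%:E + (h' s ^+ 2)%:E))%E); last first.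
  rewrite ge0_integralD//; last 2 first.
  - by move=> s _; rewrite lee_fin sqr_ge0.
  - by move=> s _; rewrite lee_fin sqr_ge0.
  exact: leeD2r.
rewrite -ge0_integralZl_EFin//; last 2 first.
- by move=> s _; rewrite -EFinM lee_fin mulr_ge0.
- exact: emeasurable_funM.
apply: ge0_le_integral => //.
- by move=> s _; rewrite -!EFinM lee_fin !mulr_ge0.
- by apply: emeasurable_funM => //; exact: emeasurable_funM.
- exact: emeasurable_funD.
move=> s _; rewrite -!EFinM -EFinD lee_fin.
by have := sqr_ge0 (L K s - h' s); rewrite sqrrB; lra.
Qed.

End kl_bound.

Theorem theorem9 (R : realType) :
  exists2 C : R, 0 < C &
  forall (n d K B : nat) (eta sigma M : R)
    (g : nat -> 'I_n -> 'rV[R]_d -> 'rV[R]_d)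
    (F : nat -> 'I_n -> 'I_n -> 'rV[R]_d -> 'rV[R]_d -> 'rV[R]_d)
    (d1 : measure_display) (T1 : measurableType d1) (P1 : probability T1 R)
    (d2 : measure_display) (T2 : measurableType d2) (P2 : probability T2 R)
    (x noise : process n d P1) (xh noiseh : process n d P2)
    (I : nat -> 'I_n -> 'I_B -> T2 -> 'I_n),
  (1 <= B <= n)%N -> 0 < eta -> 0 < sigma ->
  (forall k i, measurable_fun setT (g k i)) ->
  (forall k i j, measurable_fun setT
     (fun z : 'rV[R]_d * 'rV[R]_d => F k i j z.1 z.2)) ->
  is_IPD g F eta sigma x noise ->
  is_RBM g F eta sigma I xh noiseh ->
  (forall A : set (n.-tuple 'rV[R]_d), measurable A ->
     distribution P2 (config xh 0) A = distribution P1 (config x 0) A) ->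
  (forall k i j, (k <= K)%N ->
     \forall w \ae P2, norm2 (F k i j (xh k i w) (xh k j w)) <= M) ->
  (* eta <= B sigma^2 / (40 M^2 d), which is no constraint when M = 0 *)
  eta * (40 * M ^+ 2 * d%:R) <= B%:R * sigma ^+ 2 ->
  (KL (distribution P2 (trajectory xh K)) (distribution P1 (trajectory x K)) <=
   (C * (eta ^+ 2 * M ^+ 4 * n%:R * K%:R / (B%:R ^+ 2 * sigma ^+ 4)
         + d%:R * eta ^+ 3 * M ^+ 6 * n%:R * K%:R * (1 + ln B%:R) ^+ 2
           / (B%:R ^+ 4 * sigma ^+ 6)))%:E)%E.
Proof.
exists 64; first by [].
move=> n d K B eta sigma M g F d1 T1 P1 d2 T2 P2 x noise xh noiseh I.
move=> Bn eta0 sigma0 mg mF ipd rbm start bound small.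
have /andP[B0 _] := Bn.
have B0R : 0 < B%:R :> R by rewrite ltr0n.
set A1 := eta ^+ 2 * _ * _ * _ / _.
have M4 : 0 <= M ^+ 4 by rewrite (exprM _ 2 2) sqr_ge0.
have M6 : 0 <= M ^+ 6 by rewrite (exprM _ 3 2) sqr_ge0.
have [eta2 eta3] : 0 <= eta ^+ 2 /\ 0 <= eta ^+ 3 by split; exact/exprn_ge0/ltW.
have [sigma4 sigma6] : 0 <= sigma ^+ 4 /\ 0 <= sigma ^+ 6 by split; exact/exprn_ge0/ltW.
have [B2 B4] : 0 <= B%:R ^+ 2 :> R /\ 0 <= B%:R ^+ 4 :> R by split; exact/exprn_ge0/ler0n.
have lnB := sqr_ge0 (1 + ln B%:R : R).
have A20 : 0 <= d%:R * eta ^+ 3 * M ^+ 6 * n%:R * K%:R * (1 + ln B%:R) ^+ 2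
    / (B%:R ^+ 4 * sigma ^+ 6).
  by do ![apply: divr_ge0 => // | apply: mulr_ge0 => //].
suff H : (KL (distribution P2 (trajectory xh K)) (distribution P1 (trajectory x K))
    <= (64 * A1)%:E)%E.
  by apply: le_trans H _; rewrite lee_fin ler_wpM2l// lerDl.
have [d0|d0] := posnP d.
  (* all forces vanish, so the bound holds with [M] replaced by [0] *)
  have bound0 k i j : (k <= K)%N ->
      \forall w \ae P2, norm2 (F k i j (xh k i w) (xh k j w)) <= 0.
    move=> _; apply: aeW => w; rewrite /norm2 big1 ?sqrtr0// => l _.
    by exfalso; move: (nat_of_ord l) (ltn_ord l) => p; rewrite d0.
  have small0 : eta * (40 * 0 ^+ 2) <= B%:R * sigma ^+ 2.
    by rewrite expr0n/= !mulr0 mulr_ge0 ?sqr_ge0.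
  apply: le_trans (KL_trajectory_le Bn eta0 sigma0 mg mF ipd rbm start bound0 small0) _.
  rewrite lee_fin (expr0n _ 4)/= !(mulr0, mul0r) mulr_ge0// /A1.
  by do ![apply: divr_ge0 => // | apply: mulr_ge0 => //].
(* Here [1 <= d] is used: the stated step-size condition then implies the one without [d]. *)
have small1 : eta * (40 * M ^+ 2) <= B%:R * sigma ^+ 2.
  apply: le_trans small; rewrite ler_pM2l// -[leLHS]mulr1 ler_wpM2l ?ler1n//.
  by rewrite mulr_ge0// sqr_ge0.
apply: le_trans (KL_trajectory_le Bn eta0 sigma0 mg mF ipd rbm start bound small1) _.
by rewrite lee_fin /A1 le_eqVlt; apply/orP; left; apply/eqP; field; rewrite !gt_eqF.
Qed.
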